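(* Let $n=2l$ with $l\ge 1$. (Direct problem.) Let $b_0,\dots,b_{n-1}\in\mathbb{R}\setminus\{0\}$ and let $J_n$ be the Schwarz matrix with entries $b_0,\dots,b_{n-1}$. The characteristic polynomial $p(z)=\det(zE_n-J_n)$ is generalized Hurwitz of type I if and only if $$b_0>0,\quad b_1b_2>0,\quad b_3b_4>0,\ \dots,\ b_{n-3}b_{n-2}>0$$ (that is, $b_0>0$ and $b_{2j-1}b_{2j}>0$ for $1\le j\le l-1$). In this case the order $\varkappa$ of $p$ equals the number of negative terms in the sequence $$b_0b_1,\quad b_0b_1b_2b_3,\quad b_0b_1b_2b_3b_4b_5,\ \dots,\ b_0b_1\cdots b_{n-1}$$ (the products $\prod_{k=0}^{2i-1}b_k$, $i=1,\dots,l$). (Inverse problem.) Conversely, let $\lambda_1,\dots,\lambda_n$ be complex numbers such that the polynomial $p(z)=\prod_{k=1}^n(z-\lambda_k)$ is generalized Hurwitz of type I of order $\varkappa$ and $\Delta_j(p)\ne 0$ for $j=1,\dots,n$. Then there exists a unique Schwarz matrix $J_n$ with nonzero real entries $b_0,\dots,b_{n-1}$ satisfying $b_0>0$, $b_1b_2>0$, $b_3b_4>0$, $\dots$, $b_{n-3}b_{n-2}>0$, such that the number of negative terms in the sequence $b_0b_1,\ b_0b_1b_2b_3,\ \dots,\ b_0b_1\cdots b_{n-1}$ equals $\varkappa$, and $\sigma(J_n)=\{\lambda_1,\dots,\lambda_n\}$ (spectrum counted with multiplicities).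
   Context: The Schwarz matrix $J_n$ with entries $b_0,\dots,b_{n-1}\in\mathbb{R}\setminus\{0\}$ is the $n\times n$ tridiagonal matrix with $(1,1)$ entry $-b_0$, all other diagonal entries $0$, all superdiagonal entries $1$, and $(k+1,k)$ entry $-b_k$ for $1\le k\le n-1$. $E_n$ is the $n\times n$ identity matrix. Hurwitz determinants: for a monic real polynomial $p(z)=z^n+a_1z^{n-1}+\cdots+a_n$ put $a_0=1$ and $a_i=0$ for $i<0$ or $i>n$; then $\Delta_j(p)=\det\left[a_{2s-r}\right]_{r,s=1}^{j}$ ($r$ the row index, $s$ the column index), $j=1,\dots,n$. $[\alpha]$ is the largest integer not exceeding $\alpha$. Generalized Hurwitz polynomials: a real polynomial $p$ of degree $n$ is generalized Hurwitz of type I of order $\varkappa$, $1\le\varkappa\le\left[\frac{n+1}{2}\right]$, if it has exactly $\varkappa$ zeroes in the closed right half-plane, all of which are nonnegative and simple, $0\le\mu_1<\mu_2<\dots<\mu_\varkappa$, such that: $p(-\mu_i)\ne0$ for $i=2,\dots,\varkappa$, and $p(-\mu_1)\neq 0$ if $\mu_1>0$; $p$ has an odd number of zeroes, counting multiplicities, on each of the intervals $(-\mu_\varkappa,-\mu_{\varkappa-1}),\dots,(-\mu_3,-\mu_2),(-\mu_2,-\mu_1)$; the number of zeroes of $p$ on $(-\mu_1,0)$ (if any) is even, counting multiplicities; the other real zeroes lie on $(-\infty,-\mu_\varkappa)$, an odd number of them counting multiplicities if $n$ is even, and an even number if $n$ is odd; all nonreal zeroes (if any) lie in the open left half-plane.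 A real polynomial is generalized Hurwitz of type I of order $0$ if it is Hurwitz stable, i.e. all its zeroes lie in the open left half-plane. A polynomial is generalized Hurwitz of type I if it is so of some order $\varkappa\ge0$. *)

(* Defs.v *)
From HB Require Import structures.
From mathcomp Require Import all_boot all_order all_algebra.
From mathcomp Require Import reals.
From mathcomp Require Import complex.

Set Implicit Arguments.
Unset Strict Implicit.
Unset Printing Implicit Defensive.

Import Order.TTheory GRing.Theory Num.Theory.
Local Open Scope ring_scope.

Definition degree (R : realType) (p : {poly R}) : nat := (size p).-1.

(* All complex zeroes of the real polynomial p, repeated according to
   multiplicity; meaningful only for p != 0. *)
Definition zeros (R : realType) (p : {poly R}) : seq R[i] :=
  sval (closed_field_poly_normal (map_poly (real_complex R) p)).

(* Number of real zeroes of p in the interval I, with multiplicity. *)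
Definition nzeros_in (R : realType) (p : {poly R}) (I : interval R) : nat :=
  count (fun z => (complex.Im z == 0) && (complex.Re z \in I)) (zeros p).

Definition hurwitz_stable (R : realType) (p : {poly R}) : Prop :=
  p != 0 /\ forall z, z \in zeros p -> complex.Re z < 0.

(* Here mu`_0 < ... < mu`_(kappa - 1) stand for mu_1 < ... < mu_kappa. Since
   zeros p carries multiplicities, zeros_rhp says that there are exactly kappa
   zeroes in the closed right half-plane, all of them nonnegative and simple. *)
Record hurwitzI_pos (R : realType) (p : {poly R}) (kappa : nat)
    (mu : kappa.-tuple R) : Prop := HurwitzIPos {
  hurwitzI_nonzero : p != 0;
  hurwitzI_order_bounds : (1 <= kappa <= (degree p).+1 %/ 2)%N;
  hurwitzI_mu_ge0 : forall i, (i < kappa)%N -> 0 <= mu`_i;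
  hurwitzI_mu_increasing : forall i, (i.+1 < kappa)%N -> mu`_i < mu`_i.+1;
  hurwitzI_zeros_rhp :
    perm_eq [seq z <- zeros p | 0 <= complex.Re z]
            [seq real_complex R x | x <- mu];
  hurwitzI_opp_mu : forall i, (0 < i < kappa)%N -> p.[- mu`_i] != 0;
  hurwitzI_opp_mu1 : 0 < mu`_0 -> p.[- mu`_0] != 0;
  hurwitzI_between : forall i, (i.+1 < kappa)%N ->
    odd (nzeros_in p `](- mu`_i.+1), (- mu`_i)[);
  hurwitzI_near0 : ~~ odd (nzeros_in p `](- mu`_0), 0[);
  hurwitzI_other_real : forall x, root p x ->
    [\/ x \in (mu : seq R),
        exists2 i, (i.+1 < kappa)%N & x \in `](- mu`_i.+1), (- mu`_i)[,
        x \in `](- mu`_0), 0[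
      | x < - mu`_kappa.-1];
  hurwitzI_far : odd (nzeros_in p `]-oo, (- mu`_kappa.-1)[) = ~~ odd (degree p);
  hurwitzI_nonreal : forall z, z \in zeros p ->
    complex.Im z != 0 -> complex.Re z < 0
}.

Definition hurwitzI_of_order (R : realType) (p : {poly R}) (kappa : nat) :
    Prop :=
  if kappa is 0%N then hurwitz_stable p
  else exists mu : kappa.-tuple R, hurwitzI_pos p mu.

Definition hurwitzI (R : realType) (p : {poly R}) : Prop :=
  exists kappa, hurwitzI_of_order p kappa.

(* Ordinals are 0-based, so the subdiagonal entry - b_k, at (k+1, k) with
   1-based indices, is the one in row k here. *)
Definition schwarz_mx (R : realType) (n : nat) (b : n.-tuple R) : 'M[R]_n :=
  \matrix_(i < n, j < n)
    if (j == i.+1 :> nat) then 1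
    else if (i == j.+1 :> nat) then - b`_i
    else if (i == 0%N :> nat) && (j == 0%N :> nat) then - b`_0
    else 0.

Definition spectrum (R : realType) (n : nat) (A : 'M[R]_n) : seq R[i] :=
  zeros (char_poly A).

(* The coefficient a_i of p = z^n + a_1 z^(n-1) + ... + a_n. *)
Definition hcoef (R : realType) (p : {poly R}) (i : int) : R :=
  match i with
  | Posz k => if (k <= degree p)%N then p`_(degree p - k) else 0
  | Negz _ => 0
  end.

Definition hurwitz_det (R : realType) (p : {poly R}) (j : nat) : R :=
  \det (\matrix_(r < j, s < j) hcoef p (2 * (s.+1)%:Z - (r.+1)%:Z)).

Definition schwarz_cond (R : realType) (l : nat) (b : seq R) : Prop :=
  0 < b`_0 /\
  forall j, (1 <= j <= l.-1)%N -> 0 < b`_(2 * j - 1) * b`_(2 * j).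

Definition num_neg_products (R : realType) (l : nat) (b : seq R) : nat :=
  count (fun i => \prod_(0 <= k < 2 * i) b`_k < 0) (iota 1 l).

(* Main.v *)
(** Let [p] be the characteristic polynomial. By a Christoffel-Darboux identity,
    [(p(x) p(y) - p(-x) p(-y)) / (2 (x + y))] is the kernel
    [K(x, y) = \sum_k b_0 ... b_k G_(k+1)(x) G_(k+1)(y)], where [G_k], of degree
    [n - k], is the continuant of the rows from [k] on. Factoring [p] over its
    zeroes [z_j] also writes [K] as a diagonal form with coefficients [- Re z_j],
    so at most as many products [b_0 ... b_k] are negative as there are zeroes in
    the open right half-plane. As [n] is even, [G_(k+1)] is even for odd [k], and
    the odd-[k] part of [K] is [(K(x, y) + K(x, -y)) / 2]. On positive zeroes [mu_i]
    it is minus a Cauchy form plus the diagonal terms [p(-mu_i) p'(mu_i) / 4], which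
    are negative by the interlacing conditions; so at least as many odd-[k]
    products are negative as there are positive zeroes. The two bounds together
    force all even-[k] products to be positive and identify the order. Conversely,
    if the even-[k] products are positive then so is the even-[k] part
    [(K(x, y) - K(x, -y)) / 2]; at a nonreal zero this gives [Re z < 0], at a
    positive zero [p(-mu) p'(mu) < 0], which amounts to the interlacing
    conditions.

    For the inverse problem, Gaussian elimination on the Hurwitz matrix follows
    the three-term recursion of the [G_k], so nonvanishing Hurwitz determinants
    produce nonzero entries [b_k]. *)

Require Import Defs.
From HB Require Import structures.
From mathcomp Require Import all_boot all_order all_algebra.
From mathcomp Require Import reals.
From mathcomp Require Import complex polyrcf.
From mathcomp Require Import ring lra zify.

Set Implicit Arguments.
Unset Strict Implicit.
Unset Printing Implicit Defensive.

Import Order.TTheory GRing.Theory Num.Theory.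
Local Open Scope ring_scope.

(** * Continuants and the Christoffel-Darboux kernel *)

(* [cont x b m k] is the [m] x [m] continuant with diagonal entries [x] built on
   [b k.+1, ..., b (k + m).-1]; in particular [b k] does not occur in it. *)
Fixpoint cont (A : comNzRingType) (x : A) (b : nat -> A) (m k : nat) : A :=
  match m with
  | 0%N => 1
  | m'.+1 => x * cont x b m' k.+1 +
             match m' with
             | 0%N => 0
             | m''.+1 => b k.+1 * cont x b m'' k.+2
             end
  end.

(** This is $\det(xE_n-J_n)$ with the corner entry $x+b_0$ split into its two terms. The two
    summands have opposite parity in [x]. *)
Definition schwarz_poly (A : comNzRingType) (n : nat) (b : nat -> A) (x : A) : A :=
  cont x b n 0 + b 0 * cont x b n.-1 1.

Definition bprod (A : comNzRingType) (b : nat -> A) (k : nat) : A :=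
  \prod_(0 <= i < k.+1) b i.

Definition kernel (A : comNzRingType) (n : nat) (b : nat -> A) (x y : A) : A :=
  \sum_(0 <= j < n) bprod b j * (cont x b (n - j.+1) j.+1 * cont y b (n - j.+1) j.+1).

Section Continuants.
Variable A : comNzRingType.
Implicit Types (x y : A) (b : nat -> A) (m n k : nat).

Lemma contSS x b m k :
  cont x b m.+2 k = x * cont x b m.+1 k.+1 + b k.+1 * cont x b m k.+2.
Proof. by []. Qed.

Lemma cont1 x b k : cont x b 1 k = x.
Proof. by rewrite /= mulr1 addr0. Qed.

Lemma cont_ind (P : nat -> nat -> Prop) :
  (forall k, P 0 k) -> (forall k, P 1 k) ->
  (forall m k, P m.+1 k.+1 -> P m k.+2 -> P m.+2 k) -> forall m k, P m k.
Proof.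
move=> H0 H1 H2 m; suff [] : (forall k, P m k) /\ (forall k, P m.+1 k) by [].
elim: m => [|m [IH0 IH1]]; first by split.
by split=> // k; apply: H2.
Qed.

Lemma eq_cont x b b' m k : (forall i, (k < i < k + m)%N -> b i = b' i) ->
  cont x b m k = cont x b' m k.
Proof.
move: m k; apply: cont_ind => // m k IH1 IH2 e.
rewrite !contSS e ?IH1 ?IH2 //; try lia.
  by move=> i ?; apply: e; lia.
by move=> i ?; apply: e; lia.
Qed.

Lemma contN x b m k : cont (- x) b m k = (-1) ^+ m * cont x b m k.
Proof.
move: m k; apply: cont_ind => [k|k|m k IH1 IH2].
- by rewrite /= mulr1.
- by rewrite !cont1 expr1 mulN1r.
- by rewrite !contSS IH1 IH2 !exprS; ring.
Qed.

Lemma bprodS b k : bprod b k.+1 = bprod b k * b k.+1.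
Proof. by rewrite /bprod big_nat_recr. Qed.

Lemma bprod0 b : bprod b 0 = b 0.
Proof. by rewrite /bprod big_nat1. Qed.

(** In the induction step the recursion for the two larger continuants splits off $(x+y)$ times the
    summand [j = k]; the rest carries $b_{k+1}$ and is the left side at [k.+1], one size smaller. *)
Lemma cont_kernel x y b m k :
  bprod b k * (cont x b m.+1 k * cont y b m k.+1 + cont x b m k.+1 * cont y b m.+1 k)
  = (x + y) * \sum_(k <= j < k + m.+1)
      bprod b j * (cont x b (k + m.+1 - j.+1) j.+1 * cont y b (k + m.+1 - j.+1) j.+1).
Proof.
elim: m k => [|m IH] k.
  by rewrite addn1 big_nat1 subnn !cont1 /=; ring.
rewrite !contSS big_ltn; last by lia.
have -> : (k + m.+2 = k.+1 + m.+1)%N by lia.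
rewrite [in RHS]mulrDr -IH bprodS.
have -> : (k.+1 + m.+1 - k.+1 = m.+1)%N by lia.
ring.
Qed.

Lemma schwarz_polyN x b n : (0 < n)%N ->
  schwarz_poly n b (- x) = (-1) ^+ n * (cont x b n 0 - b 0 * cont x b n.-1 1).
Proof. by case: n => // n _; rewrite /schwarz_poly !contN exprS; ring. Qed.

(* A Christoffel-Darboux identity. *)
Lemma schwarz_kernel x y b n : (0 < n)%N ->
  schwarz_poly n b x * schwarz_poly n b y
    - schwarz_poly n b (- x) * schwarz_poly n b (- y)
  = 2 * ((x + y) * kernel n b x y).
Proof.
move=> n0; rewrite !schwarz_polyN //; case: n n0 => // n _.
have := cont_kernel x y b n 0; rewrite add0n bprod0 /kernel => <-.
have sgn : (-1) ^+ n.+1 * (-1) ^+ n.+1 = 1 :> A by rewrite -expr2 sqrr_sign.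
rewrite mulrACA sgn /schwarz_poly /=; ring.
Qed.

(** For even [n] the size [n - j.+1] has the parity of [j.+1], so replacing [y] by [- y] flips
    exactly the terms with even [j]. *)
Lemma kernelN x y b n : ~~ odd n ->
  kernel n b x (- y) = \sum_(0 <= j < n) (-1) ^+ j.+1 *
     (bprod b j * (cont x b (n - j.+1) j.+1 * cont y b (n - j.+1) j.+1)).
Proof.
move=> evn; apply: eq_big_nat => j /andP[_ jn].
rewrite contN -signr_odd oddB // (negbTE evn) addFb signr_odd; ring.
Qed.

Lemma kernel_odd x y b n : ~~ odd n ->
  2 * (\sum_(0 <= j < n | odd j)
     bprod b j * (cont x b (n - j.+1) j.+1 * cont y b (n - j.+1) j.+1))
  = kernel n b x y + kernel n b x (- y).
Proof.
move=> evn; rewrite kernelN // -big_split /= mulr_sumr big_mkcond.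
apply: eq_bigr => j _; rewrite -signr_odd /=; case: (odd j) => /=; ring.
Qed.

Lemma kernel_even x y b n : ~~ odd n ->
  2 * (\sum_(0 <= j < n | ~~ odd j)
     bprod b j * (cont x b (n - j.+1) j.+1 * cont y b (n - j.+1) j.+1))
  = kernel n b x y - kernel n b x (- y).
Proof.
move=> evn; rewrite kernelN // -sumrB mulr_sumr big_mkcond.
apply: eq_bigr => j _; rewrite -signr_odd /=; case: (odd j) => /=; ring.
Qed.

End Continuants.

Section Morphism.
Variables (A B : comNzRingType) (f : {rmorphism A -> B}).

Lemma rmorph_cont x b m k : f (cont x b m k) = cont (f x) (f \o b) m k.
Proof.
move: m k; apply: cont_ind => [k|k|m k IH1 IH2].
- by rewrite /= rmorph1.
- by rewrite !cont1.
- by rewrite !contSS rmorphD !rmorphM IH1 IH2.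
Qed.

Lemma rmorph_schwarz_poly x b n :
  f (schwarz_poly n b x) = schwarz_poly n (f \o b) (f x).
Proof. by rewrite /schwarz_poly rmorphD rmorphM !rmorph_cont. Qed.

Lemma rmorph_bprod b k : f (bprod b k) = bprod (f \o b) k.
Proof. exact: rmorph_prod. Qed.

End Morphism.

Definition contX (A : comNzRingType) (b : nat -> A) m k : {poly A} :=
  cont 'X (polyC \o b) m k.

Definition schwarz_polyX (A : comNzRingType) (n : nat) (b : nat -> A) : {poly A} :=
  schwarz_poly n (polyC \o b) 'X.

Lemma horner_contX (A : comNzRingType) (b : nat -> A) m k x :
  (contX b m k).[x] = cont x b m k.
Proof.
rewrite /contX; move: m k; apply: cont_ind => [k|k|m k IH1 IH2].
- by rewrite /= hornerC.
- by rewrite !cont1 hornerX.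
- by rewrite !contSS hornerD !hornerM hornerX hornerC IH1 IH2.
Qed.

Lemma horner_schwarz_polyX (A : comNzRingType) n (b : nat -> A) x :
  (schwarz_polyX n b).[x] = schwarz_poly n b x.
Proof.
by rewrite /schwarz_poly -!horner_contX /schwarz_polyX /schwarz_poly hornerD hornerM hornerC.
Qed.

Lemma contX_monic_size (A : comNzRingType) (b : nat -> A) m k :
  contX b m k \is monic /\ size (contX b m k) = m.+1.
Proof.
rewrite /contX; move: m k; apply: cont_ind => [k|k|m k [mo1 s1] [mo2 s2]].
- by rewrite /= monic1 size_poly1.
- by rewrite cont1 monicX size_polyX.
- rewrite contSS; set P := cont _ _ m.+1 _ in mo1 s1 *.
  set Q := cont _ _ m _ in mo2 s2 *.
  have sXP : size ('X * P) = m.+3 by rewrite mulrC size_mulX ?s1 ?monic_neq0.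
  have lt : (size ((b k.+1)%:P * Q)%R < size ('X * P)%R)%N.
    by rewrite sXP /= mul_polyC (leq_ltn_trans (size_scale_leq _ _)) ?s2.
  by rewrite size_polyDl // sXP monicE lead_coefDl // mulrC lead_coefMX -monicE.
Qed.

Lemma schwarz_polyX_monic_size (A : comNzRingType) n (b : nat -> A) : (0 < n)%N ->
  schwarz_polyX n b \is monic /\ size (schwarz_polyX n b) = n.+1.
Proof.
case: n => // n _; rewrite /schwarz_polyX /schwarz_poly /=.
have [mo1 s1] := contX_monic_size b n.+1 0.
have [_ s2] := contX_monic_size b n 1; rewrite /contX in mo1 s1 s2.
have lt : (size ((b 0%N)%:P * cont 'X (polyC \o b) n 1)%R
           < size (cont 'X (polyC \o b) n.+1 0))%N.
  by rewrite s1 mul_polyC (leq_ltn_trans (size_scale_leq _ _)) ?s2.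
by rewrite monicE lead_coefDl // -monicE mo1 size_polyDl // s1.
Qed.

(** * Tridiagonal determinants and the characteristic polynomial *)

Section CharPoly.
Variables (A : comNzRingType) (x : A) (b : nat -> A).

(** The corner [c] is separate because the Schwarz matrix has $z+b_0$ there, while after one
    expansion every diagonal entry is [x]. *)
Definition tridiag_mx (c : A) (m k : nat) : 'M[A]_m :=
  \matrix_(i, j) if j == i.+1 :> nat then - 1
                 else if i == j.+1 :> nat then b (k + i)
                 else if i == j then (if i == 0 :> nat then c else x)
                 else 0.

Lemma det_tridiagSS c m k :
  \det (tridiag_mx c m.+2 k)
  = c * \det (tridiag_mx x m.+1 k.+1) + b k.+1 * \det (tridiag_mx x m k.+2).
Proof.
rewrite (expand_det_row _ 0) !big_ord_recl big1 ?addr0 => [|i _]; last first.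
  by rewrite !mxE /= mul0r.
have e : (0 == 0 :> 'I_m.+2) = true by [].
rewrite !mxE /= /cofactor /= !add0n expr0 !mul1r; congr (_ * \det _ + _).
  apply/matrixP => i j; rewrite !mxE /= !(inj_eq lift_inj).
  by rewrite /bump /= !add1n !eqSS addSnnS; case: (i == 0 :> nat).
(* In the minor of the superdiagonal entry, [b k.+1] is the only nonzero entry of the first
   column. *)
rewrite (expand_det_col _ 0) big_ord_recl big1 ?addr0 => [|i _]; last first.
  by rewrite !mxE /= mul0r.
rewrite !mxE /= /cofactor /= expr0 expr1 mul1r addn1 !mulN1r opprK.
congr (_ * \det _); apply/matrixP => i j; rewrite !mxE /= /bump /= !add1n.
rewrite !eqSS !addnS !addSn -!val_eqE /= /bump /= !add1n !eqSS.
by case: (i == 0 :> nat).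
Qed.

Lemma det_tridiag m k : \det (tridiag_mx x m k) = cont x b m k.
Proof.
move: m k; apply: cont_ind => [k|k|m k IH1 IH2]; first exact: det_mx00.
  by rewrite det_mx11 mxE cont1.
by rewrite det_tridiagSS IH1 IH2.
Qed.

End CharPoly.

Lemma char_poly_schwarz (R : realType) (n : nat) (b : n.-tuple R) : (0 < n)%N ->
  char_poly (schwarz_mx b) = schwarz_polyX n (nth 0 b).
Proof.
move=> n0; rewrite /schwarz_polyX /char_poly.
have -> : char_poly_mx (schwarz_mx b)
    = tridiag_mx 'X (polyC \o nth 0 b) ('X + (b`_0)%:P) n 0.
  apply/matrixP => i j; rewrite !mxE -!val_eqE /=.
  case: (ltngtP i j) => ij.
  - case: eqP => _; first by rewrite sub0r.
    rewrite (_ : (i == j.+1 :> nat) = false); last by lia.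
    rewrite (_ : (j == 0%N :> nat) = false) ?andbF ?subrr //; lia.
  - rewrite (_ : (j == i.+1 :> nat) = false); last by lia.
    case: eqP => _; first by rewrite sub0r rmorphN opprK.
    rewrite (_ : (i == 0%N :> nat) = false) ?subrr //; lia.
  - rewrite ij (_ : (j == j.+1 :> nat) = false); last by lia.
    rewrite andbb; case: eqP => _; first by rewrite rmorphN opprK mulr1n.
    by rewrite subr0 mulr1n.
case: n n0 {b} (nth 0 b) => // -[|n] _ b.
  by rewrite det_mx11 mxE /schwarz_poly cont1 /= mulr1.
rewrite det_tridiagSS !det_tridiag /schwarz_poly contSS /= -/(cont _ _ n.+1 1). ring.
Qed.

(** * Inertia *)

Section Telescope.
Variable A : comNzRingType.

(** The mixed product in the telescoping of $\prod(x-w'_j)-\prod(x+w_j)$: factors before [k] come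
    from the first product, those after [k] from the second. *)
Definition tele_term (s : seq (A * A)) (k : nat) (x : A) : A :=
  (\prod_(0 <= j < k) (x - (s`_j).2)) * (\prod_(k.+1 <= j < size s) (x + (s`_j).1)).

Lemma prodB_telescope n (F G : nat -> A) :
  \prod_(0 <= j < n) F j - \prod_(0 <= j < n) G j
  = \sum_(0 <= k < n) (\prod_(0 <= j < k) F j) * (F k - G k)
                        * (\prod_(k.+1 <= j < n) G j).
Proof.
elim: n => [|n IH]; first by rewrite !big_nil subrr.
rewrite [in RHS]big_nat_recr //= [\prod_(n.+1 <= j < n.+1) _]big_geq // mulr1.
rewrite !big_nat_recr //=.
transitivity (\prod_(0 <= i < n) F i * (F n - G n)
  + (\prod_(0 <= j < n) F j - \prod_(0 <= j < n) G j) * G n); first by ring.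
rewrite IH mulr_suml addrC; congr (_ + _).
apply: eq_big_nat => k /andP[_ kn].
by rewrite -mulrA big_nat_recr.
Qed.

(* For a pair [z = (w, w')] one has
   [(x - w') (y - w) - (x + w) (y + w') = - (x + y) (w + w')]. *)
Lemma root_telescope (s : seq (A * A)) x y :
  \prod_(z <- s) ((x - z.2) * (y - z.1)) - \prod_(z <- s) ((x + z.1) * (y + z.2))
  = (x + y) * \sum_(0 <= k < size s) - ((s`_k).1 + (s`_k).2) *
       (tele_term s k x * tele_term [seq (z.2, z.1) | z <- s] k y).
Proof.
rewrite (big_nth 0) [X in _ - X](big_nth 0) prodB_telescope mulr_sumr.
apply: eq_big_nat => k /andP[_ ks].
rewrite /tele_term size_map !big_split /=.
have e1 : \prod_(0 <= j < k) (y - ([seq (z.2, z.1) | z <- s]`_j).2)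
          = \prod_(0 <= j < k) (y - (s`_j).1).
  by apply: eq_big_nat => j /andP[_ jk]; rewrite (nth_map 0) //; apply: ltn_trans ks.
have e2 : \prod_(k.+1 <= j < size s) (y + ([seq (z.2, z.1) | z <- s]`_j).1)
          = \prod_(k.+1 <= j < size s) (y + (s`_j).2).
  by apply: eq_big_nat => j /andP[_ jk]; rewrite (nth_map 0).
rewrite e1 e2; ring.
Qed.

End Telescope.

(* A space on which a diagonal form is negative definite meets the span of the
   nonnegative coordinates trivially. *)
Lemma neg_index (F : numFieldType) k m (M : 'M[F]_(k, m)) (e : 'I_m -> F) :
  (forall j, e j \is Num.real) ->
  (forall w : 'rV_k, w != 0 -> \sum_j e j * `|(w *m M) 0 j| ^+ 2 < 0) ->
  (k <= #|[pred j | (e j < 0)%R]|)%N.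
Proof.
move=> ereal neg; rewrite leqNgt; apply/negP => lt.
set P := [pred j | e j < 0] in lt *.
pose N : 'M[F]_(k, #|P|) := \matrix_(i, j) M i (enum_val j).
have kn0 : kermx N != 0.
  rewrite -mxrank_eq0 mxrank_ker subn_eq0 -ltnNge.
  exact: leq_ltn_trans (rank_leq_col N) lt.
have /rowV0Pn[w wk w0] := kn0.
have /lt_geF/negP := neg w w0; apply.
apply: sumr_ge0 => j _; have [jP|jP] := boolP (j \in P).
  have wN : w *m N = 0 by apply/sub_kermxP.
  have -> : (w *m M) 0 j = (w *m N) 0 (enum_rank_in jP j).
    by rewrite !mxE; apply: eq_bigr => i _; rewrite mxE enum_rankK_in.
  by rewrite wN mxE normr0 expr0n mulr0.
apply: mulr_ge0; last exact: exprn_ge0.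
by rewrite real_leNgt // ?real0.
Qed.

(** * Factorization of a real polynomial over its complex zeroes *)

Section Zeros.
Variable R : realType.
Implicit Types (p : {poly R}) (z : R[i]) (x : R).

Lemma zeros_prod p : p \is monic ->
  map_poly (real_complex R) p = \prod_(z <- zeros p) ('X - z%:P).
Proof.
move=> /monicP mp; rewrite /zeros; case: closed_field_poly_normal => r /= e.
by rewrite [LHS]e lead_coef_map mp rmorph1 scale1r.
Qed.

Lemma size_zeros p : p \is monic -> size (zeros p) = degree p.
Proof.
move=> mp; rewrite /degree -(size_map_poly (real_complex R)) zeros_prod //.
by rewrite size_prod_XsubC.
Qed.

Lemma mem_zeros p z : p \is monic ->
  (z \in zeros p) = root (map_poly (real_complex R) p) z.
Proof. by move=> mp; rewrite zeros_prod // root_prod_XsubC. Qed.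

Lemma mem_zeros_real p x : p \is monic -> (real_complex R x \in zeros p) = root p x.
Proof. by move=> mp; rewrite mem_zeros // fmorph_root. Qed.

Lemma horner_map_conjc p z :
  (map_poly (real_complex R) p).[conjc z] = conjc (map_poly (real_complex R) p).[z].
Proof.
rewrite -horner_map /= -map_poly_comp; congr (_.[_]).
by apply: eq_map_poly => x; exact/esym/conjc_real.
Qed.

Lemma horner_zeros p z : p \is monic ->
  (map_poly (real_complex R) p).[z] = \prod_(a <- zeros p) (z - a).
Proof.
move=> mp; rewrite zeros_prod // horner_prod.
by apply: eq_bigr => a _; rewrite !hornerE.
Qed.

(** The zeroes of a real polynomial are closed under conjugation. With both factorizations each zero
    can be paired with its conjugate, which produces $z+\bar z=2\,\mathrm{Re}\,z$. *)
Lemma horner_zeros_conjc p z : p \is monic ->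
  (map_poly (real_complex R) p).[z] = \prod_(a <- zeros p) (z - conjc a).
Proof.
move=> mp; rewrite -[z]conjcK horner_map_conjc horner_zeros // rmorph_prod.
by apply: eq_bigr => a _; rewrite rmorphB.
Qed.

End Zeros.

Lemma rmorph_tele_term (A B : comNzRingType) (f : {rmorphism A -> B})
    (s : seq (A * A)) k x :
  f (tele_term s k x) = tele_term [seq (f z.1, f z.2) | z <- s] k (f x).
Proof.
rewrite /tele_term rmorphM !rmorph_prod size_map.
have [ks|ks] := ltnP k (size s).
  congr (_ * _); apply: eq_big_nat => j /andP[_ jk].
    by rewrite rmorphB (nth_map 0) //; apply: ltn_trans ks.
  by rewrite rmorphD (nth_map 0).
congr (_ * _); last by rewrite !big_geq //; apply: leqW.
apply: eq_big_nat => j _; rewrite rmorphB.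
have [js|js] := ltnP j (size s); first by rewrite (nth_map 0).
by rewrite !nth_default ?size_map // !rmorph0.
Qed.

(** Indexing by the size [d] of the continuants makes their coefficient matrix triangular. *)
Lemma kernel_ord (A : comNzRingType) n (b : nat -> A) x y :
  kernel n b x y
  = \sum_(d < n) bprod b (n - d.+1) * (cont x b d (n - d) * cont y b d (n - d)).
Proof.
rewrite /kernel big_mkord (reindex_inj rev_ord_inj) /=; apply: eq_bigr => d _.
have -> : ((n - d.+1).+1 = n - d)%N by have := ltn_ord d; lia.
by have -> : (n - (n - d) = d)%N by have := ltn_ord d; lia.
Qed.

Lemma bilin_form (A : comNzRingType) n m (M N : 'M[A]_(n, m)) (e : 'I_m -> A) (u v : 'rV_n) :
  \sum_j e j * ((u *m M) 0 j * (v *m N) 0 j)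
  = \sum_i \sum_i' u 0 i * v 0 i' * \sum_j e j * (M i j * N i' j).
Proof.
under eq_bigr => j _.
  rewrite !mxE big_distrlr /= mulr_sumr.
  under eq_bigr => i _ do rewrite mulr_sumr.
  over.
rewrite exchange_big; apply: eq_bigr => i _; rewrite exchange_big.
apply: eq_bigr => i' _; rewrite mulr_sumr; apply: eq_bigr => j _; ring.
Qed.

(** The form depends on [M] and [e] only through the entries of $M\,\mathrm{diag}(e)\,M^*$, so two
    factorizations of one kernel matrix give the same form. *)
Lemma herm_form (R : realType) n m (M : 'M[R[i]]_(n, m)) (e : 'I_m -> R[i]) (w : 'rV_n) :
  \sum_j e j * `|(w *m M) 0 j| ^+ 2
  = \sum_i \sum_i' w 0 i * conjc (w 0 i') * \sum_j e j * (M i j * conjc (M i' j)).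
Proof.
have wJ j : conjc ((w *m M) 0 j) = (map_mx conjc w *m map_mx conjc M) 0 j.
  by rewrite -(map_mxM conjc) [RHS]mxE.
under eq_bigr => j _ do rewrite sqr_normc wJ.
rewrite bilin_form; apply: eq_bigr => i _; apply: eq_bigr => i' _.
by rewrite mxE; congr (_ * _); apply: eq_bigr => j _; rewrite mxE.
Qed.

Lemma card_ord_count (T : Type) (x0 : T) (a : pred T) (s : seq T) n : size s = n ->
  #|[pred j : 'I_n | a (nth x0 s j)]| = count a s.
Proof. by move=> <-; rewrite -sum1_card -sum1_count (big_nth x0) big_mkord. Qed.

(** The matrix is a Vandermonde matrix times a triangular one with unit diagonal, since
    [contX b d (n - d)] is monic of degree [d]. *)
Lemma cont_nodes_unit (F : fieldType) n (b : nat -> F) (t : 'rV[F]_n) :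
  injective (t 0) ->
  \matrix_(i < n, d < n) cont (t 0 i) b d (n - d) \in unitmx.
Proof.
move=> tinj.
pose T : 'M[F]_n := \matrix_(d, j) (contX b d (n - d))`_j.
have -> : \matrix_(i < n, d < n) cont (t 0 i) b d (n - d)
          = (Vandermonde n t)^T *m T^T.
  apply/matrixP => i d; rewrite !mxE -horner_contX.
  have [_ s] := contX_monic_size b d (n - d).
  rewrite (horner_coef_wide (n := n)) ?s //.
  by apply: eq_bigr => j _; rewrite !mxE mulrC.
rewrite unitmx_mul !unitmx_tr !unitmxE !unitfE det_Vandermonde; apply/andP; split.
  apply/prodf_neq0 => i _; apply/prodf_neq0 => j ij.
  by rewrite subr_eq0 (inj_eq tinj) neq_ltn ij orbT.
rewrite det_trig; last first.
  apply/is_trig_mxP => i j ij; rewrite mxE nth_default //.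
  by have [_ ->] := contX_monic_size b i (n - i).
apply/prodf_neq0 => i _; rewrite mxE.
have [/monicP mo s] := contX_monic_size b i (n - i).
by move: mo; rewrite /lead_coef s /= => ->; rewrite oner_eq0.
Qed.

(** * Negative products and zeroes in the right half-plane *)

Section NegativeProducts.
Variables (R : realType) (n : nat) (b : nat -> R).
Hypothesis n_gt0 : (0 < n)%N.
Let p := schwarz_polyX n b.
Let bC := real_complex R \o b.
Let zs := zeros p.
Let pairs := [seq (z, conjc z) | z <- zs].

Lemma size_zeros_schwarz : size zs = n.
Proof.
have [mo s] := schwarz_polyX_monic_size b n_gt0.
by rewrite size_zeros // /degree s.
Qed.

Lemma horner_map_schwarz z :
  (map_poly (real_complex R) p).[z] = schwarz_poly n bC z.
Proof.
rewrite -horner_schwarz_polyX /p /schwarz_polyX; congr (_.[z]).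
rewrite rmorph_schwarz_poly /= map_polyX /schwarz_poly; congr (_ + _ * _) => /=.
- by apply: eq_cont => i _; rewrite /= map_polyC.
- by rewrite map_polyC.
- by apply: eq_cont => i _; rewrite /= map_polyC.
Qed.

Lemma kernel_tele (x y : R[i]) : x + y != 0 ->
  kernel n bC x y = \sum_(j < n) - (real_complex R (complex.Re zs`_j)) *
     (tele_term pairs j x * tele_term [seq (z.2, z.1) | z <- pairs] j y).
Proof.
move=> xy0; have [mo _] := schwarz_polyX_monic_size b n_gt0.
have two0 : 2 != 0 :> R[i] by rewrite pnatr_eq0.
apply: (mulfI xy0); apply: (mulfI two0).
rewrite -schwarz_kernel // -!horner_map_schwarz.
(* $p(x)$ and $p(-y)$ are factored over the conjugates, $p(y)$ and $p(-x)$ over the zeroes, to match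
   [root_telescope] with $w=z$, $w'=\bar z$. *)
rewrite (horner_zeros_conjc x mo) (horner_zeros y mo) (horner_zeros (- x) mo).
rewrite (horner_zeros_conjc (- y) mo) -/zs -!big_split /=.
have := root_telescope pairs x y; rewrite !big_map size_map size_zeros_schwarz /=.
under [X in _ - X = _]eq_bigr => z _.
  rewrite -[(x + z) * _]mulrNN !opprD; over.
move=> ->; rewrite mulrCA big_mkord; congr (_ * _).
rewrite mulr_sumr; apply: eq_bigr => j _.
rewrite (nth_map 0) ?size_zeros_schwarz //= addcJ; ring.
Qed.

(** One half of Sylvester's law of inertia: the kernel matrix at [n] nodes is
    $N\,\mathrm{diag}(c)\,N^*$ with [N] invertible, and also $F\,\mathrm{diag}(e)\,F^*$ with
    $e_j=-\mathrm{Re}\,z_j$. Through $N^{-1}$, the coordinates with $c_d<0$ give a negative definite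
    space of the second form. *)
Lemma neg_bprod_le :
  (#|[pred k : 'I_n | (bprod b k < 0)%R]|
   <= count (fun z => 0 < complex.Re z)%R (zeros p))%N.
Proof.
(* Positive real nodes are fixed by conjugation and keep every sum of two nodes nonzero, as
   [kernel_tele] requires. *)
pose t : 'rV[R[i]]_n := \row_i (i.+1)%:R.
have tinj : injective (t 0).
  by move=> i j; rewrite !mxE => /eqP; rewrite eqr_nat eqSS => /eqP/val_inj.
have t0 i j : t 0 i + t 0 j != 0 by rewrite !mxE -natrD pnatr_eq0.
have tconj i : conjc (t 0 i) = t 0 i by rewrite mxE rmorph_nat.
pose N : 'M[R[i]]_n := \matrix_(i < n, d < n) cont (t 0 i) bC d (n - d).
have Nu : N \in unitmx := cont_nodes_unit _ tinj.
pose c (d : 'I_n) := bprod b (n - d.+1).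
pose P := [pred d : 'I_n | (c d < 0)%R].
(* The rows of [S] are the unit vectors of the negative coordinates. *)
pose S : 'M[R[i]]_(#|P|, n) := \matrix_(i, d) (enum_val i == d)%:R.
pose F : 'M[R[i]]_n := \matrix_(i, j) tele_term pairs j (t 0 i).
pose e (j : 'I_n) := - real_complex R (complex.Re zs`_j).
have -> : #|[pred k : 'I_n | (bprod b k < 0)%R]| = #|P|.
  by rewrite -!sum1_card (reindex_inj rev_ord_inj).
have -> : count (fun z => 0 < complex.Re z) zs = #|[pred j | e j < 0]|.
  rewrite -(card_ord_count 0 _ size_zeros_schwarz); apply: eq_card => j.
  by rewrite !inE /= /e oppr_lt0 -(rmorph0 (real_complex R)) ltcR.
apply: (neg_index (M := S *m invmx N *m F)) => [j|y y0].
  by rewrite rpredN; apply/complex_realP; eexists.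
have swap : [seq (conjc z.1, conjc z.2) | z <- pairs] = [seq (z.2, z.1) | z <- pairs].
  by rewrite -!map_comp; apply: eq_map => z /=; rewrite conjcK.
have Fe i j : F i j = tele_term pairs j (t 0 i) by rewrite mxE.
have FJ i j : conjc (F i j) = tele_term [seq (z.2, z.1) | z <- pairs] j (t 0 i).
  by rewrite Fe (rmorph_tele_term conjc) /= swap tconj.
have Ne i d : N i d = cont (t 0 i) bC d (n - d) by rewrite mxE.
have NJ i d : conjc (N i d) = cont (t 0 i) bC d (n - d).
  rewrite Ne (rmorph_cont conjc) /= tconj; apply: eq_cont => k _.
  exact: conjc_real.
(* Both sides are the Hermitian form of the kernel matrix at [y *m S *m invmx N]. *)
have -> : \sum_j e j * `|(y *m (S *m invmx N *m F)) 0 j| ^+ 2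
        = \sum_d real_complex R (c d) * `|(y *m S) 0 d| ^+ 2.
  have -> : y *m S = (y *m S *m invmx N) *m N by rewrite mulmxKV.
  rewrite !mulmxA !herm_form; apply: eq_bigr => i _; apply: eq_bigr => i' _.
  congr (_ * _); transitivity (kernel n bC (t 0 i) (t 0 i')).
    by rewrite kernel_tele //; apply: eq_bigr => j _; rewrite FJ Fe.
  rewrite kernel_ord; apply: eq_bigr => d _.
  by rewrite NJ Ne rmorph_bprod.
have yS (d : 'I_n) : (y *m S) 0 d != 0 -> c d < 0.
  rewrite mxE; apply: contraNT => cd; apply/eqP/big1 => i _; rewrite mxE.
  case: eqP => [id|_]; last by rewrite mulr0.
  by have := enum_valP i; rewrite id inE (negbTE cd).
have yS' i : (y *m S) 0 (enum_val i) = y 0 i.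
  rewrite mxE (bigD1 i) //= mxE eqxx mulr1 big1 ?addr0 // => j ji.
  by rewrite mxE (inj_eq enum_val_inj) (negbTE ji) mulr0.
have /rV0Pn[i yi] := y0.
have term_le (d : 'I_n) : real_complex R (c d) * `|(y *m S) 0 d| ^+ 2 <= 0.
  have [->|/yS cd] := eqVneq ((y *m S) 0 d) 0; first by rewrite normr0 expr0n mulr0.
  by apply: mulr_le0_ge0; rewrite ?exprn_ge0 // -(rmorph0 (real_complex R)) lecR ltW.
rewrite (bigD1 (enum_val i)) //= ltr_nwDl ?sumr_le0 // yS'.
rewrite nmulr_rlt0 ?exprn_gt0 ?normr_gt0 // -(rmorph0 (real_complex R)) ltcR.
by apply: yS; rewrite yS'.
Qed.

End NegativeProducts.
(** In [root_telescope] with $w=w'=-m$ the second product vanishes at each $\mu_i$. Dividing by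
    $D(\mu_i)D(\mu_j)$ writes the Cauchy matrix as a Gram matrix with weights $2\mu_k>0$. *)
Lemma cauchy_form_ge0 (F : realFieldType) (mu : seq F) (w : 'I_(size mu) -> F) :
  (forall x, x \in mu -> 0 < x) ->
  0 <= \sum_(i < size mu) \sum_(j < size mu) w i * w j / (mu`_i + mu`_j).
Proof.
move=> mu_gt0; pose s := [seq (- m, - m) | m <- mu].
have mug (i : 'I_(size mu)) : 0 < mu`_i by rewrite mu_gt0 // mem_nth.
have addg (i j : 'I_(size mu)) : 0 < mu`_i + mu`_j by rewrite addr_gt0.
pose D x := \prod_(m <- mu) (x + m).
have Dgt (i : 'I_(size mu)) : 0 < D mu`_i.
  rewrite /D big_seq; apply: prodr_gt0 => m mm.
  by rewrite addr_gt0 ?mu_gt0 // mem_nth.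
have ent (i j : 'I_(size mu)) : (mu`_i + mu`_j)^-1 = \sum_(k < size mu) 2 * mu`_k *
    ((tele_term s k mu`_i / D mu`_i) * (tele_term s k mu`_j / D mu`_j)).
  have := root_telescope s mu`_i mu`_j.
  rewrite [X in _ - X]big_map (big_rem mu`_i) ?mem_nth //= subrr !mul0r subr0.
  rewrite big_map size_map /= big_split /= => e.
  have e1 (x : F) : \prod_(m <- mu) (x - - m) = D x.
    by apply: eq_bigr => m _; rewrite opprK.
  move: e; rewrite !e1 => e.
  apply: (mulfI (lt0r_neq0 (addg i j))); rewrite divff ?lt0r_neq0 //.
  rewrite -[LHS](@divff _ (D mu`_i * D mu`_j)) ?mulf_neq0 ?lt0r_neq0 //.
  rewrite {1}e -mulrA; congr (_ * _); rewrite mulr_suml big_mkord.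
  apply: eq_bigr => k _; rewrite (nth_map 0) //= -map_comp.
  rewrite (eq_map (g := fun m => (- m, - m))) // invfM; ring.
have -> : \sum_(i < size mu) \sum_(j < size mu) w i * w j / (mu`_i + mu`_j)
   = \sum_(k < size mu) 2 * mu`_k *
       (\sum_(i < size mu) w i * (tele_term s k mu`_i / D mu`_i)) ^+ 2.
  under [RHS]eq_bigr => k _.
    rewrite expr2 big_distrlr /= mulr_sumr.
    under eq_bigr => i _ do rewrite mulr_sumr.
    over.
  rewrite [RHS]exchange_big; apply: eq_bigr => i _; rewrite [RHS]exchange_big.
  apply: eq_bigr => j _; rewrite ent mulr_sumr; apply: eq_bigr => k _; ring.
by apply: sumr_ge0 => k _; rewrite mulr_ge0 ?sqr_ge0 // mulr_ge0 // ltW.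
Qed.

(** * Negative products and positive zeroes *)

Section PositiveRoots.
Variables (R : realType) (n : nat) (b : nat -> R).
Hypotheses (n_gt0 : (0 < n)%N) (n_even : ~~ odd n).
Let p := schwarz_polyX n b.

(** At $y=-x$ both sides of the Christoffel-Darboux identity vanish; differentiating in [y] there
    removes the factor $x+y$. *)
Lemma kernel_root_opp (x : R) : root p x ->
  2 * kernel n b x (- x) = p.[- x] * p^`().[x].
Proof.
move=> /rootP px0.
pose k := kernel n (polyC \o b) x%:P 'X.
have hk y : k.[y] = kernel n b x y.
  rewrite /k /kernel horner_sum; apply: eq_bigr => j _.
  rewrite !hornerM -[cont 'X _ _ _]/(contX b _ _) horner_contX -rmorph_cont hornerC.
  by rewrite -(rmorph_bprod polyC) hornerC.
have := schwarz_kernel x%:P 'X (polyC \o b) n_gt0.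
rewrite -[schwarz_poly n _ 'X]/p -/k -polyCN.
rewrite -!(rmorph_schwarz_poly polyC) -!(horner_schwarz_polyX n b) -/p px0 rmorph0.
rewrite mul0r sub0r.
have -> : schwarz_poly n (polyC \o b) (- 'X) = p \Po (- 'X).
  rewrite -[RHS]/(comp_poly _ _) rmorph_schwarz_poly /= comp_polyX.
  rewrite /schwarz_poly /= comp_polyC; congr (_ + _ * _).
    by apply: eq_cont => i _; rewrite /= comp_polyC.
  by apply: eq_cont => i _; rewrite /= comp_polyC.
move/(congr1 (fun q => q^`().[- x])).
rewrite !(derivE, deriv_comp) !hornerE /= !horner_comp !hornerE opprK -hk.
move=> e; transitivity ((1 + 1) * (k.[- x] + (x - x) * k^`().[- x])); first by ring.
rewrite -e; ring.
Qed.

Lemma le_odd_neg_bprod (mu : seq R) : uniq mu ->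
  (forall x, x \in mu -> [/\ 0 < x, root p x & p.[- x] * p^`().[x] < 0]) ->
  (size mu <= #|[pred k : 'I_n | odd k && (bprod b k < 0)%R]|)%N.
Proof.
move=> umu mup.
pose M : 'M[R]_(size mu, n) := \matrix_(i, k) cont mu`_i b (n - k.+1) k.+1.
pose e (k : 'I_n) := if odd k then bprod b k else 0.
have -> : #|[pred k : 'I_n | odd k && (bprod b k < 0)%R]| = #|[pred k | e k < 0]|.
  by apply: eq_card => k; rewrite !inE /e; case: odd; rewrite ?ltxx.
apply: (neg_index (M := M)) => [j|w w0]; first exact: num_real.
under eq_bigr => j _ do rewrite real_normK ?num_real // expr2.
rewrite bilin_form.
have mui (i : 'I_(size mu)) : mu`_i \in mu by rewrite mem_nth.
pose a (i : 'I_(size mu)) := p.[- mu`_i].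
(* The first term is $2K(\mu_i,\mu_j)$. The second is $2K(\mu_i,-\mu_j)$, which vanishes for
   distinct zeroes and is given by [kernel_root_opp] on the diagonal. *)
have ent (i j : 'I_(size mu)) : 4 * (\sum_k e k * (M i k * M j k))
    = - (a i * a j) / (mu`_i + mu`_j) + (i == j)%:R * (a i * p^`().[mu`_i]).
  have [i0 /rootP ri ai] := mup _ (mui i); have [j0 /rootP rj aj] := mup _ (mui j).
  have -> : \sum_k e k * (M i k * M j k) = \sum_(0 <= j0 < n | odd j0)
     bprod b j0 * (cont mu`_i b (n - j0.+1) j0.+1 * cont mu`_j b (n - j0.+1) j0.+1).
    rewrite [RHS]big_mkcond big_mkord; apply: eq_bigr => k _; rewrite /e !mxE.
    by case: odd; rewrite ?mul0r.
  rewrite (_ : 4 = 2 * 2) -?mulrA ?kernel_odd //; last by rewrite -natrM.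
  rewrite mulrDr; congr (_ + _).
    have ij0 : mu`_i + mu`_j != 0 by rewrite lt0r_neq0 // addr_gt0.
    apply: (mulfI ij0); rewrite mulrCA -schwarz_kernel // -!horner_schwarz_polyX -/p.
    by rewrite ri mul0r sub0r mulrCA divff // mulr1.
  have [<-|ij] := eqVneq i j; first by rewrite mul1r kernel_root_opp //; apply/rootP.
  have ij0 : mu`_i - mu`_j != 0.
    by rewrite subr_eq0 nth_uniq // -val_eqE in ij *.
  apply: (mulfI ij0); rewrite mulrCA -schwarz_kernel // -!horner_schwarz_polyX -/p.
  by rewrite opprK ri rj !mul0r mulr0 subrr mulr0.
have four0 : 0 < 4 :> R by rewrite ltr0n.
rewrite -(pmulr_rlt0 _ four0).
have -> : 4 * (\sum_i \sum_i' w 0 i * w 0 i' * (\sum_j e j * (M i j * M i' j)))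
   = - (\sum_i \sum_j (w 0 i * a i) * (w 0 j * a j) / (mu`_i + mu`_j))
     + \sum_i w 0 i ^+ 2 * (a i * p^`().[mu`_i]).
  rewrite -sumrN -big_split mulr_sumr; apply: eq_bigr => i _ /=.
  rewrite mulr_sumr -sumrN.
  transitivity (\sum_j (- (w 0 i * a i * (w 0 j * a j) / (mu`_i + mu`_j))
     + w 0 i * w 0 j * ((i == j)%:R * (a i * p^`().[mu`_i])))).
    apply: eq_bigr => j _; rewrite mulrCA ent mulrDr; congr (_ + _); ring.
  rewrite big_split /=; congr (_ + _).
  rewrite (bigD1 i) //= eqxx mul1r -expr2 big1 ?addr0 // => j /negbTE ji.
  by rewrite eq_sym ji mul0r mulr0.
have /rV0Pn[i wi] := w0.
have neg j : a j * p^`().[mu`_j] < 0 by have [] := mup _ (mui j).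
apply: ltr_wnDl; first by rewrite oppr_le0 cauchy_form_ge0 // => x /mup[].
rewrite (bigD1 i) //= ltr_nwDl //.
  by rewrite pmulr_rlt0 ?neg // exprn_even_gt0.
by apply: sumr_le0 => j _; rewrite mulr_ge0_le0 ?sqr_ge0 // ltW ?neg.
Qed.

End PositiveRoots.
(** * Parity of the number of real zeroes *)

Section RealZeros.
Variable R : realType.
Implicit Types (p q : {poly R}) (x a : R) (I J : interval R).

Definition real_zeros p : seq R :=
  [seq complex.Re z | z <- zeros p & complex.Im z == 0].

Lemma nzeros_inE p I : nzeros_in p I = count (mem I) (real_zeros p).
Proof.
rewrite /nzeros_in /real_zeros count_map count_filter; apply: eq_count => z /=.
by rewrite andbC.
Qed.

Lemma zeros_mul_XsubC r q : q \is monic ->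
  perm_eq (zeros (('X - r%:P) * q)) (real_complex R r :: zeros q).
Proof.
move=> mq; apply: prod_XsubC_eq.
rewrite big_cons -!zeros_prod ?monicMl ?monicXsubC // rmorphM rmorphB.
by rewrite /= map_polyX map_polyC.
Qed.

Lemma real_zeros_mul_XsubC r q : q \is monic ->
  perm_eq (real_zeros (('X - r%:P) * q)) (r :: real_zeros q).
Proof.
move=> mq; rewrite /real_zeros.
have /(perm_filter (fun z => complex.Im z == 0)) := zeros_mul_XsubC r mq.
by move=> /(perm_map (@complex.Re R)) /=; rewrite eqxx.
Qed.

Lemma mem_real_zeros p x : p \is monic -> (x \in real_zeros p) = root p x.
Proof.
move=> mp; rewrite -mem_zeros_real //; apply/mapP/idP => [[[u v]]|xz].
  by rewrite mem_filter /= => /andP[/eqP -> uz] ->.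
by exists (real_complex R x); rewrite ?mem_filter /= ?eqxx.
Qed.

(** Without real roots the sign is constant, so it agrees with the signs at both infinities, $1$ and
    $(-1)^{\deg p}$. *)
Lemma no_root_sign p : p \is monic -> (forall x, ~~ root p x) ->
  ~~ odd (degree p) /\ forall a, 0 < p.[a].
Proof.
move=> mp nr.
have pos a : Num.sg p.[a] = 1.
  rewrite (sgp_pinftyP (x := a)) ?in_itv /= ?lexx //.
  by rewrite /sgp_pinfty (monicP mp) sgr1.
split=> [|a]; last by rewrite -sgr_gt0 pos ltr01.
have := pos 0; rewrite (sgp_minftyP (x := 0)) ?in_itv /= ?lexx //.
rewrite /sgp_minfty (monicP mp) mulr1 -signr_odd /degree.
case: odd => //=; rewrite expr1 sgrN sgr1 => /(congr1 (fun u => 0 < u)).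
by rewrite oppr_gt0 ltr01 ltr10.
Qed.

(** Dividing out a real zero [r] changes both parities of the first claim, and flips sign and count
    exactly at the points left of [r]; the induction ends at a polynomial without real zeroes. *)
Lemma real_zeros_parity p : p \is monic ->
  odd (size (real_zeros p)) = odd (degree p) /\
  forall a, ~~ root p a -> (p.[a] < 0) = odd (nzeros_in p `]a, +oo[).
Proof.
move: {2}(size p) (leqnn (size p)) => n; elim: n p => [|n IH] p sp mp.
  by move: sp; rewrite leqn0 size_poly_eq0 (negbTE (monic_neq0 mp)).
have [z|nil] := boolP (real_zeros p == [::]).
  have nr x : ~~ root p x by rewrite -mem_real_zeros // (eqP z).
  have [deg pos] := no_root_sign mp nr; rewrite (eqP z) /= (negbTE deg); split=> // a _.
  by rewrite nzeros_inE (eqP z) /= lt_gtF.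
have [r rp] : exists r, r \in real_zeros p.
  by case: (real_zeros p) nil => // r s _; exists r; rewrite mem_head.
move: rp; rewrite mem_real_zeros // => /factor_theorem[q]; rewrite mulrC => pq.
have mq : q \is monic by move: mp; rewrite pq monicMl ?monicXsubC.
have q0 := monic_neq0 mq.
have spq : size p = (size q).+1.
  by rewrite pq size_monicM ?monicXsubC // size_XsubC.
have [] := IH q _ mq; first by rewrite -ltnS -spq.
have pe := real_zeros_mul_XsubC r mq.
move=> par sgn; split.
  rewrite pq (perm_size pe) /= par /degree -pq spq /=.
  by rewrite -size_poly_gt0 in q0; rewrite -{2}(prednK q0).
move=> a; rewrite pq rootM root_XsubC negb_or hornerM !hornerE => /andP[ar qa].
rewrite nzeros_inE (permP pe) /= -nzeros_inE oddD -sgn // oddb in_itv /= andbT.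
case: (ltgtP r a) ar => // ra _ /=.
  by rewrite pmulr_rlt0 // subr_gt0.
rewrite nmulr_rlt0 ?subr_lt0 // lt0r -rootE qa /=.
by rewrite leNgt.
Qed.

End RealZeros.
Lemma count_gt_nth (F : realDomainType) (s : seq F) i : sorted <%R s -> (i < size s)%N ->
  count (fun x => s`_i < x) s = (size s - i.+1)%N.
Proof.
elim: s i => // x s IH [|i] /= xs; rewrite subSS.
  move=> _; rewrite ltxx subn0 add0n; apply/eqP; rewrite -all_count.
  by apply: order_path_min xs; apply: lt_trans.
move=> ilt; rewrite IH ?(path_sorted xs) //.
have /allP/(_ s`_i) : all (> x) s by apply: order_path_min xs; apply: lt_trans.
by rewrite mem_nth // => /(_ isT)/lt_gtF ->.
Qed.

Section RealZerosSign.
Variables (R : realType) (p : {poly R}).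
Hypothesis p_monic : p \is monic.
Implicit Types (x a : R).

(** The interval conditions are asked only at roots, so an interval can be cut at any point that is
    not a root. *)
Lemma nzeros_in_split (I J K : interval R) :
  (forall x, root p x -> (x \in K) = (x \in I) (+) (x \in J)) ->
  (forall x, root p x -> ~~ ((x \in I) && (x \in J))) ->
  nzeros_in p K = (nzeros_in p I + nzeros_in p J)%N.
Proof.
move=> hK dIJ; rewrite !nzeros_inE.
have : {subset real_zeros p <= root p} by move=> x; rewrite mem_real_zeros.
elim: (real_zeros p) => // x s IH sub /=.
rewrite IH => [|y ys]; last by apply: sub; rewrite inE ys orbT.
have rx : root p x by apply: sub; rewrite mem_head.
rewrite hK //; have := dIJ x rx.
by case: (x \in I); case: (x \in J) => //= _; rewrite ?addnS.
Qed.

Lemma nzeros_split_at a c : a < c -> ~~ root p a ->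
  nzeros_in p `]-oo, c[ = (nzeros_in p `]-oo, a[ + nzeros_in p `]a, c[)%N.
Proof.
move=> ac ra; apply: nzeros_in_split => x rx; rewrite !in_itv /=; last first.
  by case: ltgtP.
case: (ltgtP x a) => [xa|xa|xa].
- by rewrite (lt_trans xa ac).
- by [].
- by move: ra; rewrite -xa rx.
Qed.

Lemma sign_right a : ~~ root p a -> (p.[a] < 0) = odd (nzeros_in p `]a, +oo[).
Proof. by have [_] := real_zeros_parity p_monic; apply. Qed.

(** In even degree the number of real zeroes is even, so the counts on the two sides of [a] have
    equal parity. *)
Lemma sign_left a : ~~ odd (degree p) -> ~~ root p a ->
  (p.[a] < 0) = odd (nzeros_in p `]-oo, a[).
Proof.
move=> deg ra; rewrite sign_right //.
have [par _] := real_zeros_parity p_monic.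
have : odd (nzeros_in p `]-oo, +oo[) = false.
  transitivity (odd (degree p)); last exact/negbTE.
  by rewrite -par nzeros_inE -[in RHS]count_predT.
rewrite (nzeros_in_split (I := `]-oo, a[) (J := `]a, +oo[)).
- by rewrite oddD; move: (odd _) (odd _) => [] [].
- move=> x rx; rewrite !in_itv /= andbT.
  by case: (ltgtP x a) => // xa; move: ra; rewrite -xa rx.
- by move=> x _; rewrite !in_itv /= andbT; case: ltgtP.
Qed.

(** Writing $p=(X-x)q$ gives $p'(x)=q(x)$, and [q] has the same zeroes as [p] to the right of
    [x]. *)
Lemma deriv_root x : root p x ->
  (p^`().[x] != 0) = (count_mem x (real_zeros p) == 1)%N /\
  (p^`().[x] != 0 -> (p^`().[x] < 0) = odd (nzeros_in p `]x, +oo[)).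
Proof.
move=> /factor_theorem[q]; rewrite mulrC => pq.
have mq : q \is monic by move: p_monic; rewrite pq monicMl ?monicXsubC.
have pe := real_zeros_mul_XsubC x mq.
have -> : p^`().[x] = q.[x].
  by rewrite pq derivM derivXsubC !hornerE subrr; ring.
rewrite nzeros_inE pq !(permP pe) /= eqxx in_itv /= ltxx add0n -nzeros_inE.
split; last by move=> qx; have [_] := real_zeros_parity mq; apply; rewrite rootE.
by rewrite eqSS -rootE -(mem_real_zeros _ mq) -has_pred1 has_count lt0n negbK.
Qed.

End RealZerosSign.

(** * Interlacing as a sign condition at the positive zeroes *)

Section PositiveZeros.
Variables (R : realType) (p : {poly R}) (mu : seq R).
Hypotheses (p_monic : p \is monic) (mu_sorted : sorted <%R mu).
Hypothesis mu_perm : perm_eq [seq x <- real_zeros p | 0 < x] mu.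

Lemma mem_pos_zeros x : (x \in mu) = (0 < x) && root p x.
Proof. by rewrite -(perm_mem mu_perm) mem_filter mem_real_zeros. Qed.

Lemma nzeros_gt_nth i : (i < size mu)%N ->
  nzeros_in p `]mu`_i, +oo[ = (size mu - i.+1)%N.
Proof.
move=> ilt; rewrite -count_gt_nth // -(permP mu_perm) count_filter nzeros_inE.
have : mu`_i \in mu by rewrite mem_nth.
rewrite mem_pos_zeros => /andP[i0 _].
apply: eq_count => x /=; rewrite in_itv /= andbT.
by case: ltP => // /(lt_trans i0) ->.
Qed.

Lemma deriv_pos_zero i : (i < size mu)%N ->
  p^`().[mu`_i] != 0 /\ (p^`().[mu`_i] < 0) = odd (size mu - i.+1).
Proof.
move=> ilt; have imu : mu`_i \in mu by rewrite mem_nth.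
move: (imu); rewrite mem_pos_zeros => /andP[i0 ri].
have [e1 e2] := deriv_root p_monic ri.
have d0 : p^`().[mu`_i] != 0.
  rewrite e1 (_ : count_mem _ _ = count_mem mu`_i mu).
    by rewrite count_uniq_mem ?imu // (sorted_uniq _ _ mu_sorted) //; apply: lt_trans.
  rewrite -(permP mu_perm) count_filter; apply: eq_count => x /=.
  by case: eqP => [->|//]; rewrite i0.
by rewrite e2 // nzeros_gt_nth.
Qed.

(** The sign of $p(-\mu_i)$ is read off the zeroes to its left, that of $p'(\mu_i)$ off the
    [size mu - i.+1] zeroes to the right of $\mu_i$; opposite signs mean opposite parities, whence
    [size mu - i]. *)
Lemma opp_deriv_lt0 i : ~~ odd (degree p) -> (i < size mu)%N ->
  (p.[- mu`_i] * p^`().[mu`_i] < 0)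
  = (p.[- mu`_i] != 0) && (odd (nzeros_in p `]-oo, (- mu`_i)[) == odd (size mu - i)).
Proof.
move=> deg ilt; have [d0 ds] := deriv_pos_zero ilt.
have [->|m0] := eqVneq p.[- mu`_i] 0; first by rewrite mul0r ltxx.
rewrite -(sign_left p_monic deg) ?rootE //.
have -> : odd (size mu - i) = ~~ (p^`().[mu`_i] < 0).
  by rewrite ds -oddS -subSn // subSS.
move: m0 d0; rewrite !neq_lt => /orP[] a0 /orP[] b0 /=;
  rewrite ?a0 ?b0 ?(lt_gtF a0) ?(lt_gtF b0) /=.
- by rewrite nmulr_rlt0 // (lt_gtF b0).
- by rewrite nmulr_rlt0 // b0.
- by rewrite pmulr_rlt0 // b0.
- by rewrite pmulr_rlt0 // (lt_gtF b0).
Qed.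

End PositiveZeros.
(** * The direct problem *)

(** As the [b i] are nonzero, two consecutive zero values would propagate down the recursion to the
    continuant of size zero, which is $1$. *)
Lemma cont_consecutive_neq0 (F : idomainType) (x : F) (b : nat -> F) m k :
  (forall i, (k < i <= k + m)%N -> b i != 0) ->
  (cont x b m.+1 k != 0) || (cont x b m k.+1 != 0).
Proof.
elim: m k => [|m IH] k b0; first by rewrite /= oner_eq0 orbT.
have [c0|] := eqVneq (cont x b m.+1 k.+1) 0; last by rewrite orbT.
have : cont x b m k.+2 != 0.
  by have := IH k.+1; rewrite c0 eqxx; apply=> i ?; apply: b0; lia.
move=> c1; rewrite contSS c0 mulr0 add0r mulf_neq0 //.
by apply: b0; lia.
Qed.

(** If $p(x)=p(-x)=0$, both parity parts vanish at [x], hence two consecutive continuants do. *)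
Lemma schwarz_poly_opp_neq0 (F : numDomainType) n (b : nat -> F) x : (0 < n)%N ->
  (forall i, (i < n)%N -> b i != 0) ->
  schwarz_poly n b x = 0 -> schwarz_poly n b (- x) != 0.
Proof.
case: n => // n _ b0; rewrite schwarz_polyN // mulf_eq0 signr_eq0 /schwarz_poly succnK.
move=> px0; apply/eqP => /= px1; have two0 : 2 != 0 :> F by rewrite pnatr_eq0.
have c0 : cont x b n.+1 0 = 0.
  apply: (mulfI two0); rewrite mulr0.
  transitivity ((cont x b n.+1 0 + b 0 * cont x b n 1)
                + (cont x b n.+1 0 - b 0 * cont x b n 1)); first by ring.
  by rewrite px0 px1 addr0.
have c1 : cont x b n 1 = 0.
  by apply: (mulfI (b0 0%N isT)); rewrite mulr0 -px0 c0 add0r.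
have := @cont_consecutive_neq0 F x b n 0; rewrite c0 c1 eqxx => /(_ _)/negP[] //.
by move=> i ?; apply: b0; lia.
Qed.

Lemma count_odd_iota (a : pred nat) l :
  count (fun k => odd k && a k) (iota 0 (2 * l)) = count (fun i => a (2 * i).-1) (iota 1 l).
Proof.
elim: l => // l IH; have -> : (2 * l.+1 = 2 * l + 2)%N by lia.
rewrite -[l.+1]addn1 (iotaD 0 (2 * l)) (iotaD 1 l) !count_cat IH /=.
rewrite !add0n !addn0 add1n oddM /= add0n.
by congr (_ + nat_of_bool (a _))%N; lia.
Qed.

Section Direct.
Variables (R : realType) (n : nat) (b : nat -> R).
Hypotheses (n_gt0 : (0 < n)%N) (n_even : ~~ odd n).
Hypothesis b_neq0 : forall i, (i < n)%N -> b i != 0.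
Let p := schwarz_polyX n b.
Let p_monic : p \is monic. Proof. by have [] := schwarz_polyX_monic_size b n_gt0. Qed.
Let p_degree : degree p = n.
Proof. by have [_ s] := schwarz_polyX_monic_size b n_gt0; rewrite /degree s. Qed.
Let p_even : ~~ odd (degree p). Proof. by rewrite p_degree. Qed.
Let bC := real_complex R \o b.

Let bprod_neq0 k : (k < n)%N -> bprod b k != 0.
Proof.
move=> kn; rewrite /bprod prodf_seq_neq0; apply/allP => i.
by rewrite mem_index_iota => /andP[_ ik]; rewrite b_neq0 //; lia.
Qed.

(** For odd [k] the product $b_0\cdots b_k$ has an even number of factors, as in the sequence that
    determines the order. *)
Definition odd_neg := #|[pred k : 'I_n | odd k && (bprod b k < 0)%R]|.
Definition even_pos := forall k, (k < n)%N -> ~~ odd k -> 0 < bprod b k.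

Let zero_opp z : z \in zeros p -> - z \notin zeros p.
Proof.
rewrite !mem_zeros // !rootE !horner_map_schwarz => /eqP.
by apply: schwarz_poly_opp_neq0 => // i /b_neq0; rewrite fmorph_eq0.
Qed.

Let root_opp x : root p x -> ~~ root p (- x).
Proof.
rewrite -!mem_zeros_real // rmorphN; exact: zero_opp.
Qed.

Let root0 : ~~ root p 0.
Proof. by apply/negP => r0; have := root_opp r0; rewrite oppr0 r0. Qed.

(** The number of negative products is at least [odd_neg] and at most [kappa], so everything is an
    equality and no even index contributes. *)
Let signs_of_bounds kappa :
  (count (fun z => 0 < complex.Re z)%R (zeros p) <= kappa)%N -> (kappa <= odd_neg)%N ->
  even_pos /\ kappa = odd_neg.
Proof.
move=> le1 le2.
have le3 := leq_trans (neg_bprod_le b n_gt0) le1.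
pose N := #|[pred k : 'I_n | ~~ odd k && (bprod b k < 0)%R]|.
have e : #|[pred k : 'I_n | (bprod b k < 0)%R]| = (odd_neg + N)%N.
  rewrite -(cardID [pred k : 'I_n | odd k]) /odd_neg /N.
  congr (_ + _)%N; apply: eq_card => k; rewrite !inE //.
  by rewrite andbC.
have N0 : N = 0%N by lia.
split; last by lia.
move=> k kn odk; rewrite lt_def bprod_neq0 // leNgt.
by have := card0_eq N0 (Ordinal kn); rewrite !inE /= odk /= => ->.
Qed.

Lemma schwarz_even_pos kappa : hurwitzI_of_order p kappa -> even_pos /\ kappa = odd_neg.
Proof.
case: kappa => [[_ st]|kappa [mu H]].
  apply: signs_of_bounds => //; rewrite leqn0 -[_ == 0%N]negbK -lt0n -has_count.
  by apply/hasPn => z /st; rewrite -leNgt => /ltW.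
have smu : size mu = kappa.+1 by rewrite size_tuple.
have srt : sorted <%R mu.
  by apply/(sortedP 0) => i; rewrite smu; apply: hurwitzI_mu_increasing H _.
have mu_root x : x \in tval mu -> root p x.
  move=> xmu; rewrite -mem_zeros_real //.
  have : real_complex R x \in [seq z <- zeros p | 0 <= complex.Re z].
    by rewrite (perm_mem (hurwitzI_zeros_rhp H)) map_f.
  by rewrite mem_filter => /andP[].
have mu_gt0 x : x \in tval mu -> 0 < x.
  move=> xmu; rewrite lt_def; apply/andP; split.
    by apply: contraNneq root0 => <-; apply: mu_root.
  rewrite -(nth_index 0 xmu); apply: hurwitzI_mu_ge0 H _ _.
  by rewrite -[X in (_ < X)%N]smu index_mem.
have mu_perm : perm_eq [seq x <- real_zeros p | 0 < x] mu.
  rewrite /real_zeros filter_map -filter_predI.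
  set Q := predI _ _.
  have -> : filter Q (zeros p) = filter Q [seq z <- zeros p | 0 <= complex.Re z].
    rewrite -filter_predI; apply: eq_filter => z /=.
    by case: ltP => //= /ltW ->; rewrite andbT.
  have /(perm_filter Q)/(perm_map (@complex.Re R)) := hurwitzI_zeros_rhp H.
  move=> /perm_trans; apply; rewrite (all_filterP _) -?map_comp ?map_id //.
  by apply/allP => _ /mapP[x xmu ->]; rewrite /Q /= eqxx andbT mu_gt0.
apply: signs_of_bounds.
  rewrite -[X in (_ <= X)%N]smu -(size_map (real_complex R)) -(perm_size (hurwitzI_zeros_rhp H)).
  by rewrite size_filter; apply: sub_count => z /ltW.
have root_neg i : (i < kappa.+1)%N -> ~~ root p (- mu`_i).
  by move=> ilt; apply/root_opp/mu_root; rewrite mem_nth ?smu.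
(* Induction from the far left: an odd number of zeroes lies beyond the last $-\mu$, since the
   degree is even, and each gap adds an odd number. *)
have left j : (j <= kappa)%N -> odd (nzeros_in p `]-oo, (- mu`_(kappa - j))[) = odd j.+1.
  elim: j => [_|j IH jk].
    by rewrite subn0; have := hurwitzI_far H; rewrite /= p_even => ->.
  have e : (kappa - j = (kappa - j.+1).+1)%N by lia.
  have ilt : ((kappa - j.+1).+1 < kappa.+1)%N by lia.
  rewrite (nzeros_split_at p_monic (a := - mu`_(kappa - j))) //.
  - rewrite oddD IH 1?ltnW // e (hurwitzI_between H ilt) addbT //.
  - by rewrite ltrN2 e; apply: hurwitzI_mu_increasing H _ ilt.
  - by apply: root_neg; lia.
rewrite -{1}smu; apply: (@le_odd_neg_bprod R n b n_gt0 n_even (tval mu)) => //.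
  by apply: sorted_uniq srt => //; apply: lt_trans.
move=> x xmu; split; [exact: mu_gt0|exact: mu_root|].
have ilt : (index x mu < size mu)%N by rewrite index_mem.
rewrite -(nth_index 0 xmu); move: (index x mu) ilt => i ilt.
rewrite (opp_deriv_lt0 p_monic srt mu_perm p_even ilt).
rewrite smu in ilt; rewrite -rootE root_neg //= smu.
have := left (kappa - i)%N (leq_subr _ _); rewrite subKn => [->|//].
by rewrite subSn.
Qed.

Lemma odd_negE : odd_neg = count (fun i => bprod b (2 * i).-1 < 0) (iota 1 n./2).
Proof.
rewrite -(count_odd_iota (fun k => bprod b k < 0)) mul2n even_halfK //.
rewrite -(card_ord_count 0%N _ (size_iota 0 n)).
by apply: eq_card => k; rewrite !inE nth_iota ?add0n.
Qed.

(** Since $p(z)=p(\bar z)=0$ and $z\ne\bar z$, $K(z,-\bar z)=0$. So $K(z,\bar z)$ is twice the even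
    part, which is nonnegative, while $-|p(-z)|^2=4\,\mathrm{Re}\,z\,K(z,\bar z)$ is negative. *)
Lemma even_pos_nonreal z : even_pos -> z \in zeros p -> complex.Im z != 0 ->
  complex.Re z < 0.
Proof.
move=> epos zp imz; have zNp := zero_opp zp.
move: zp zNp; rewrite !mem_zeros // !rootE !horner_map_schwarz -/bC => /eqP pz pNz.
have bCJ x : schwarz_poly n bC (conjc x) = conjc (schwarz_poly n bC x).
  by rewrite -!horner_map_schwarz horner_map_conjc.
have Ke0 : 0 <= \sum_(0 <= j < n | ~~ odd j) bprod bC j *
    (cont z bC (n - j.+1) j.+1 * cont (conjc z) bC (n - j.+1) j.+1).
  rewrite big_nat_cond; apply: sumr_ge0 => j /andP[/andP[_ jn] oj].
  rewrite -rmorph_bprod mulr_ge0 //; first by rewrite ler0c ltW // epos.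
  have -> : cont (conjc z) bC (n - j.+1) j.+1 = conjc (cont z bC (n - j.+1) j.+1).
    rewrite (rmorph_cont conjc); apply: eq_cont => i _; exact/esym/conjc_real.
  exact: mulcJ_ge0.
have two0 : 2 != 0 :> R[i] by rewrite pnatr_eq0.
have K1 : kernel n bC z (- conjc z) = 0.
  have zz : z - conjc z != 0.
    rewrite subcJ !mulf_neq0 //; first by rewrite fmorph_eq0.
    by rewrite eq_complex /= oner_eq0 andbF.
  apply: (mulfI zz); apply: (mulfI two0).
  by rewrite -schwarz_kernel // opprK bCJ pz rmorph0 !mulr0 mul0r subrr.
have := kernel_even z (conjc z) bC n_even; rewrite K1 subr0 => Ke.
have := schwarz_kernel z (conjc z) bC n_gt0.
rewrite pz mul0r sub0r -rmorphN bCJ -Ke addcJ => e.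
rewrite ltNge; apply/negP => re0.
have : 0 <= - (schwarz_poly n bC (- z) * conjc (schwarz_poly n bC (- z))).
  by rewrite e !mulr_ge0 // ?ler0c // ler0n.
rewrite oppr_ge0 -sqr_normc => /le_gtF.
by rewrite exprn_gt0 // normr_gt0.
Qed.

(** From $-p(-x)^2=4xK(x,x)$ one gets $K(x,x)<0$; the even part being nonnegative, $K(x,-x)\le
    K(x,x)<0$. *)
Lemma even_pos_real x : even_pos -> 0 < x -> root p x -> p.[- x] * p^`().[x] < 0.
Proof.
move=> epos x0 rx; rewrite -kernel_root_opp //.
have Ke0 : 0 <= \sum_(0 <= j < n | ~~ odd j) bprod b j *
    (cont x b (n - j.+1) j.+1 * cont x b (n - j.+1) j.+1).
  rewrite big_nat_cond; apply: sumr_ge0 => j /andP[/andP[_ jn] oj].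
  by rewrite -expr2 mulr_ge0 ?sqr_ge0 // ltW // epos.
have := kernel_even x x b n_even; have := schwarz_kernel x x b n_gt0.
rewrite -!horner_schwarz_polyX -/p (rootP rx) mul0r sub0r -expr2.
have : 0 < p.[- x] ^+ 2 by rewrite exprn_even_gt0 // -rootE root_opp.
move: Ke0 (kernel n b x x) (kernel n b x (- x)) (p.[- x] ^+ 2).
move: (\sum_(0 <= j < n | _) _) => S S0 k k' q q0 e1 e2.
have : k < 0 by nra.
lra.
Qed.

Lemma even_pos_schwarz : even_pos -> hurwitzI p.
Proof.
move=> epos.
have sign x := @even_pos_real x epos.
pose mu := sort <=%R [seq x <- real_zeros p | 0 < x].
have mu_perm : perm_eq [seq x <- real_zeros p | 0 < x] mu by rewrite perm_sym perm_sort.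
(* The sign condition makes $p'$ nonzero at positive zeroes, so they are simple and the sorting is
   strict. *)
have mu_sorted : sorted <%R mu.
  rewrite sort_lt_sorted; apply: count_mem_uniq => x.
  rewrite count_filter mem_filter mem_real_zeros //.
  have [x0|x0] := boolP (0 < x); last first.
    by apply/eqP; rewrite eqn0Ngt -has_count -all_predC; apply/allP => y _ /=;
       case: eqP => [->|].
  have [rx|rx] := boolP (root p x); last first.
    apply/eqP; rewrite eqn0Ngt -has_count -all_predC; apply/allP => y.
    by rewrite mem_real_zeros //= => ry; case: eqP => // yx; move: rx; rewrite -yx ry.
  have [e _] := deriv_root p_monic rx.
  have : p^`().[x] != 0 by apply: contraTneq (sign _ x0 rx) => ->; rewrite mulr0 ltxx.
  rewrite e => /eqP c1; rewrite -[RHS]c1; apply: eq_count => y /=.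
  by case: eqP => // ->; rewrite x0.
have mem_mu x : (x \in mu) = (0 < x) && root p x := mem_pos_zeros p_monic mu_perm x.
have neg_re z : z \in zeros p -> complex.Im z != 0 -> complex.Re z < 0.
  exact: even_pos_nonreal.
have rhp : perm_eq [seq z <- zeros p | 0 <= complex.Re z] [seq real_complex R x | x <- mu].
  rewrite perm_sym; move: mu_perm; rewrite perm_sym => /(perm_map (real_complex R)).
  move=> /perm_trans; apply; rewrite /real_zeros filter_map -filter_predI -map_comp.
  rewrite (eq_in_filter (a2 := fun z => 0 <= complex.Re z)) => [|z zp].
    rewrite map_id_in // => -[u v]; rewrite mem_filter /= => /andP[u0 zp].
    by have [->//|/(neg_re _ zp)/lt_geF] := eqVneq v 0; rewrite u0.
  move: zp; case: z => u v zp /=; have [v0|/(neg_re _ zp)/lt_geF-> //] := eqVneq v 0; last first.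
    by rewrite andbF.
  rewrite andbT le_eqVlt; case: eqP => // u0.
  by move: root0; rewrite -mem_zeros_real // u0; move: zp; rewrite v0 => ->.
exists (size mu); rewrite /hurwitzI_of_order.
(* This yields the bound on the order: there are only [n./2] odd indices. *)
have mu_le : (size mu <= odd_neg)%N.
  apply: le_odd_neg_bprod => // [|x]; first exact: sorted_uniq lt_trans ltxx _ mu_sorted.
  by rewrite mem_mu => /andP[x0 rx]; split=> //; apply: sign.
case E: (size mu) => [|k].
  split; first exact: monic_neq0.
  move=> z zp; rewrite ltNge; apply/negP => z0.
  have : z \in [seq z <- zeros p | 0 <= complex.Re z] by rewrite mem_filter z0.
  by rewrite (perm_mem rhp) (size0nil E).
have root_neg i : (i < k.+1)%N -> ~~ root p (- mu`_i).
  move=> ilt; apply: root_opp; have : mu`_i \in mu by rewrite mem_nth ?E.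
  by rewrite mem_mu => /andP[].
have mu_gt0 i : (i < k.+1)%N -> 0 < mu`_i.
  move=> ilt; have : mu`_i \in mu by rewrite mem_nth ?E.
  by rewrite mem_mu => /andP[].
have mu_lt i : (i.+1 < k.+1)%N -> mu`_i < mu`_i.+1.
  by rewrite -E; move/(sortedP 0): mu_sorted; apply.
have left i : (i < k.+1)%N -> odd (nzeros_in p `]-oo, (- mu`_i)[) = odd (k.+1 - i).
  move=> ilt; have imu : mu`_i \in mu by rewrite mem_nth ?E.
  have := opp_deriv_lt0 p_monic mu_sorted mu_perm p_even (i := i).
  rewrite E => /(_ ilt); move: imu; rewrite mem_mu => /andP[i0 ri].
  by rewrite sign // => /esym/andP[_ /eqP].
exists (Tuple (introT eqP E)); split=> //=.
- exact: monic_neq0.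
- rewrite p_degree -E (leq_trans mu_le) ?E // odd_negE.
  by apply: leq_trans (count_size _ _) _; rewrite size_iota; lia.
- by move=> i /mu_gt0/ltW.
- by move=> i /andP[_ ik]; rewrite -rootE root_neg.
- by move=> _; rewrite -rootE root_neg.
- move=> i ik; have := left i (ltnW ik).
  rewrite (nzeros_split_at p_monic (a := - mu`_i.+1)) ?ltrN2 ?mu_lt ?root_neg //.
  rewrite oddD left // [in RHS]subSn; last by lia.
  by rewrite subSS /= addbC; case: odd; case: odd.
(* $p(0)$ counts negative and positive zeroes with the same parity, that of [k.+1]; so does the
   count left of $-\mu_1$, and the difference is even. *)
- have : odd (nzeros_in p `]-oo, 0[) = odd k.+1.
    rewrite -sign_left // sign_right // nzeros_inE -E -(perm_size mu_perm) size_filter.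
    by congr odd; apply: eq_count => x /=; rewrite in_itv /= andbT.
  rewrite (nzeros_split_at p_monic (a := - mu`_0)) ?oppr_lt0 ?mu_gt0 ?root_neg //.
  by rewrite oddD left // subn0 => /(canRL (addKb _)); rewrite addbb => ->.
- move=> x rx; have [x0|x0|x0] := ltgtP x 0; last first.
  + by move: root0; rewrite -x0 rx.
  + by apply: Or41; rewrite mem_mu x0.
  (* A negative root is located by passing the points $-\mu_i$ from right to left, none of which is
     a root. *)
  have key j : (j < k.+1)%N -> [\/ x < - mu`_j,
      exists2 i, (i < j)%N & x \in `](- mu`_i.+1), (- mu`_i)[ | x \in `](- mu`_0), 0[].
    have xN i : (i < k.+1)%N -> x != - mu`_i.
      by move=> ik; apply: contraNneq (root_neg i ik) => <-.
    elim: j => [|j IH] jk.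
      have := xN 0%N jk; rewrite neq_lt => /orP[xm|xm]; first exact: Or31.
      by apply: Or33; rewrite in_itv /= xm.
    case: (IH (ltnW jk)) => [xj|[i ij xi]|xi]; last exact: Or33; last first.
      by apply: Or32; exists i => //; apply: ltnW.
    have := xN j.+1 jk; rewrite neq_lt => /orP[xm|xm]; first exact: Or31.
    by apply: Or32; exists j => //; rewrite in_itv /= xm.
  case: (key k (ltnSn k)) => [xk|[i ik xi]|xi]; first exact: Or44.
    by apply: Or42; exists i.
  exact: Or43.
- by rewrite left // subSnn p_even.
Qed.

End Direct.
(** * Hurwitz determinants and the inverse problem *)

Section HurwitzMatrix.
Variable F : fieldType.
Implicit Types (u v w b : nat -> F) (m k i j : nat).

(** The Hurwitz matrix for $u=(a_0,a_2,\dots)$ and $v=(a_1,a_3,\dots)$: in 0-based indices the entry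
    is $a_{2c+1-r}$, so even rows hold [v], odd rows [u], and each pair of rows moves one column
    right. *)
Definition hmat u v j : 'M[F]_j :=
  \matrix_(r, c) if (c < r./2)%N then 0 else (if odd r then u else v) (c - r./2)%N.

(* Eliminating [u 0] from the odd rows by the rows above them leaves [v 0] as
   the only nonzero entry of the first column. *)
Lemma det_hmatS u v w j : v 0%N != 0 ->
  (forall i, w i = u i.+1 - u 0%N / v 0%N * v i.+1) ->
  \det (hmat u v j.+1) = v 0%N * \det (hmat v w j).
Proof.
move=> v0 hw; set t := u 0%N / v 0%N in hw.
pose E : 'M[F]_j.+1 :=
  \matrix_(r, s) ((r == s)%:R - (odd r && (s.+1 == r))%:R * t).
have detE : \det E = 1.
  rewrite det_trig.
    apply: big1 => r _; rewrite mxE eqxx (_ : (r.+1 == r) = false) ?andbF ?mul0r ?subr0 //.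
    by lia.
  apply/is_trig_mxP => r s rs; rewrite mxE -val_eqE /= (ltn_eqF rs).
  by rewrite (_ : (s.+1 == r) = false) ?andbF ?mul0r ?subr0 //; lia.
pose u' c := u c - t * v c.
have EH : E *m hmat u v j.+1 = hmat u' v j.+1.
  apply/matrixP => r c; rewrite !mxE.
  under eq_bigr => s _ do rewrite !mxE mulrBl.
  rewrite sumrB (bigD1 r) //= eqxx mul1r [X in _ + X - _]big1 ?addr0; last first.
    by move=> s sr; rewrite eq_sym (negbTE sr) mul0r.
  have [oddr|oddr] := boolP (odd r); last first.
    by rewrite big1 ?subr0 // => s _; rewrite !mul0r.
  have rlt : (r.-1 < j.+1)%N by have := ltn_ord r; lia.
  rewrite (bigD1 (Ordinal rlt)) //= big1 ?addr0; last first.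
    move=> s sr; rewrite (_ : (s.+1 == r) = false) ?mul0r //.
    by move: sr; rewrite -val_eqE /=; lia.
  have -> : (r.-1.+1 == r) by lia.
  have -> : odd r.-1 = false by lia.
  have -> : (r.-1)./2 = r./2 by lia.
  by case: ifP; rewrite mul1r ?mulr0 ?subr0.
rewrite -[LHS]mul1r -detE -det_mulmx EH (expand_det_col _ 0) big_ord_recl.
rewrite big1 ?addr0; last first.
  move=> i _; rewrite mxE /= add0n; case: ltnP => [_|]; first by rewrite mul0r.
  case: ifP => oi.
    by rewrite sub0n /u' /t divfK // subrr mul0r.
  by move: oi => /= oi; lia.
(* Removing the first row swaps the row parities, which is why the minor is [hmat v w]. *)
rewrite mxE /= subnn /cofactor addn0 expr0 mul1r; congr (_ * \det _).
apply/matrixP => r c; rewrite !mxE /= !add0n uphalf_half (_ : bump 0 c = c.+1) //.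
have [oddr|oddr] := boolP (odd r); first by rewrite /= add1n subSS.
rewrite /= add0n; have [rc|rc] := ltnP c r./2; last by rewrite ltnNge leqW //= subSn // -hw.
case: ltnP => // rc'; have -> : (c.+1 - r./2 = 0)%N by lia.
by rewrite /u' /t divfK // subrr.
Qed.

End HurwitzMatrix.

(* [cont_coef b m k i] is the coefficient of ['X^(m - 2 * i)] in [contX b m k];
   the coefficients of the other parity vanish. *)
Fixpoint cont_coef (F : fieldType) (b : nat -> F) (m k i : nat) : F :=
  match m with
  | 0%N => (i == 0%N)%:R
  | m'.+1 => cont_coef b m' k.+1 i +
             match m', i with
             | m''.+1, i'.+1 => b k.+1 * cont_coef b m'' k.+2 i'
             | _, _ => 0
             end
  end.

Section ContCoef.
Variable F : fieldType.
Implicit Types (u v b : nat -> F) (m k i j n : nat).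

Lemma cont_coef0 b m k : cont_coef b m k 0 = 1.
Proof.
move: m k; apply: cont_ind => [k|k|m k IH1 IH2] //=; first by rewrite addr0.
by rewrite -/(cont_coef b m.+1 k.+1 0) IH1 addr0.
Qed.

Lemma cont_coefSS b m k i :
  cont_coef b m.+2 k i.+1 = cont_coef b m.+1 k.+1 i.+1 + b k.+1 * cont_coef b m k.+2 i.
Proof. by []. Qed.

Lemma cont_coef_gt b m k i : (m < 2 * i)%N -> cont_coef b m k i = 0.
Proof.
move: m k i; apply: cont_ind => [k|k|m k IH1 IH2] [|i] //= mi; first by rewrite addr0.
rewrite -/(cont_coef b m.+1 k.+1 i.+1) IH1 ?IH2 ?mulr0 ?addr0 //; lia.
Qed.

Lemma eq_cont_coef b b' m k i : (forall j, (k < j)%N -> b j = b' j) ->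
  cont_coef b m k i = cont_coef b' m k i.
Proof.
move: m k i; apply: cont_ind => [k|k|m k IH1 IH2] // i e.
case: i => [|i]; first by rewrite !cont_coef0.
rewrite !cont_coefSS e ?IH1 ?IH2 // => j ?; apply: e; lia.
Qed.

Lemma coef_contX b m k j :
  (contX b m k)`_j = if (j <= m)%N && ~~ odd (m - j)
                     then cont_coef b m k (m - j)./2 else 0.
Proof.
rewrite /contX; move: m k j; apply: cont_ind => [k|k|m k IH1 IH2] j.
- by rewrite coef1; case: j.
- rewrite cont1 coefX; case: j => [|[|j]] //=.
  by rewrite addr0.
- rewrite contSS coefD coefXM coefCM IH2.
  case: j => [|j].
    rewrite eqxx !subn0 add0r !leq0n /= negbK; case: ifP => om; last by rewrite mulr0.
    rewrite -[RHS]/(cont_coef b m.+2 k m./2.+1) cont_coefSS.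
    by rewrite (@cont_coef_gt b m.+1) ?add0r //; lia.
  rewrite (_ : (j.+1 == 0)%N = false) // succnK.
  rewrite IH1 !ltnS subSS; have [jm|jm] := ltnP j m; last first.
    rewrite mulr0 addr0.
    case: ifP => //= /andP[jm' om].
    have -> : (m.+1 - j)./2 = 0%N by lia.
    by rewrite addr0.
  rewrite leqW 1?ltnW //=.
  have -> : odd (m - j.+1) = odd (m.+1 - j) by lia.
  case: ifP => om; last by rewrite mulr0 addr0.
  have -> : (m.+1 - j)./2 = ((m - j.+1)./2).+1 by lia.
  by rewrite -[RHS]/(cont_coef b m.+2 k _.+1) cont_coefSS.
Qed.

(** Only one of the two summands of [schwarz_poly] contains powers of a given parity. *)
Lemma coef_schwarz_even b m i : (2 * i <= m.+1)%N ->
  (schwarz_polyX m.+1 b)`_(m.+1 - 2 * i) = cont_coef b m.+1 0 i.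
Proof.
move=> im; rewrite /schwarz_polyX /schwarz_poly coefD coefCM.
rewrite -!/(contX b _ _) !coef_contX. rewrite leq_subr subKn //=.
rewrite mul2n odd_double doubleK /= ifF ?mulr0 ?addr0 //; last by lia.
Qed.

Lemma coef_schwarz_odd b m i : (2 * i <= m)%N ->
  (schwarz_polyX m.+1 b)`_(m - 2 * i) = b 0%N * cont_coef b m 1 i.
Proof.
move=> im; rewrite /schwarz_polyX /schwarz_poly coefD coefCM.
rewrite -!/(contX b _ _) !coef_contX. rewrite leq_subr subKn //=.
rewrite mul2n odd_double doubleK /= ifF ?add0r //; lia.
Qed.

(** The elimination step from [(u, v)] to [(v, w)] is the continuant recursion read backwards;
    nonzero determinants keep the leading values nonzero. *)
Lemma hmat_cont_coef m k u v :
  (forall i, (m.+1 < 2 * i)%N -> u i = 0) -> (forall i, (m < 2 * i)%N -> v i = 0) ->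
  u 0%N != 0 -> (forall j, (1 <= j <= m.+1)%N -> \det (hmat u v j) != 0) ->
  exists b, [/\ forall i, (k < i <= k + m)%N -> b i != 0,
    forall i, u i = u 0%N * cont_coef b m.+1 k i &
    forall i, v i = v 0%N * cont_coef b m k.+1 i].
Proof.
elim: m k u v => [|m IH] k u v usup vsup u0 dets.
  exists (fun=> 0); split=> [i|[|i]|[|i]] /=; rewrite ?addr0 ?mulr1 ?mulr0 //.
  - by lia.
  - by apply: usup; lia.
  - by apply: vsup; lia.
have v0 : v 0%N != 0.
  by have := dets 1%N isT; rewrite det_mx11 mxE.
pose w i := u i.+1 - u 0%N / v 0%N * v i.+1.
have [i|j jm|b [b0 vb wb]] := IH k.+1 v w vsup _ v0.
- move=> mi; by rewrite /w usup ?(vsup i.+1) ?mulr0 ?subr0 //; lia.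
- have /dets : (1 <= j.+1 <= m.+2)%N by lia.
  rewrite (det_hmatS _ v0 (w := w)) // mulf_eq0 negb_or.
  by case/andP.
have w0 : w 0%N != 0.
  have := dets 2%N isT; rewrite (det_hmatS _ v0 (w := w)) // mulf_eq0 negb_or.
  by rewrite det_mx11 mxE => /andP[].
(* Dividing $u_{i+1}=w_i+(u_0/v_0)v_{i+1}$ by $u_0$ and comparing with [cont_coefSS] forces this
   value of $b_{k+1}$. *)
pose c i := if i == k.+1 then w 0%N / u 0%N else b i.
have cb : forall j, (k.+1 < j)%N -> c j = b j by move=> j kj; rewrite /c gtn_eqF.
exists c; split=> [i ik|[|i]|i].
- rewrite /c; have [_|ik'] := eqVneq i k.+1; first by rewrite mulf_neq0 ?invr_eq0.
  by apply: b0; lia.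
- by rewrite cont_coef0 mulr1.
- rewrite cont_coefSS !(eq_cont_coef (b := c) (b' := b)) => [||j ?];
    try by move=> *; apply: cb; lia.
  rewrite /c eqxx mulrDr mulrA [_ * (_ / _)]mulrC divfK // -wb /w [v i.+1]vb.
  by field.
- by rewrite vb (eq_cont_coef (b := c) (b' := b)).
Qed.

(** Subtracting the second equality from the first isolates $b_{k+1}$ times the next continuant,
    whose leading coefficient $1$ reveals $b_{k+1}$; cancelling it continues the induction. *)
Lemma cont_coef_inj m k b b' : (forall i, (k < i <= k + m)%N -> b i != 0) ->
  cont_coef b m.+1 k =1 cont_coef b' m.+1 k ->
  cont_coef b m k.+1 =1 cont_coef b' m k.+1 ->
  forall i, (k < i <= k + m)%N -> b i = b' i.
Proof.
elim: m k => [|m IH] k b0 e1 e2 i ik; first by lia.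
have e3 j : b k.+1 * cont_coef b m k.+2 j = b' k.+1 * cont_coef b' m k.+2 j.
  by have := e1 j.+1; rewrite !cont_coefSS e2 => /addrI.
have bk : b k.+1 = b' k.+1 by have := e3 0%N; rewrite !cont_coef0 !mulr1.
have [->//|ik'] := eqVneq i k.+1.
apply: (IH k.+1) => // [j ?|j|]; first by apply: b0; lia.
  by apply: (mulfI (b0 k.+1 _)); rewrite ?e3 ?bk //; lia.
by lia.
Qed.

Lemma schwarz_polyX_inj n b b' : (0 < n)%N -> (forall i, (i < n)%N -> b i != 0) ->
  schwarz_polyX n b = schwarz_polyX n b' -> forall i, (i < n)%N -> b i = b' i.
Proof.
case: n => // m _ b0 e.
have ce : cont_coef b m.+1 0 =1 cont_coef b' m.+1 0.
  move=> i; have [im|im] := leqP (2 * i) m.+1; last by rewrite !cont_coef_gt.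
  by rewrite -!coef_schwarz_even // e.
have co i : b 0%N * cont_coef b m 1 i = b' 0%N * cont_coef b' m 1 i.
  have [im|im] := leqP (2 * i) m; last by rewrite !cont_coef_gt ?mulr0.
  by rewrite -!coef_schwarz_odd // e.
have e0 : b 0%N = b' 0%N by have := co 0%N; rewrite !cont_coef0 !mulr1.
move=> [|i] im //; apply: (cont_coef_inj (m := m) (k := 0)) => // [j ?|j].
  by apply: b0; lia.
by apply: (mulfI (b0 0%N isT)); rewrite co e0.
Qed.

End ContCoef.

(** * From the stated conditions to partial products and continuants *)

Section Translation.
Variable R : realType.
Implicit Types (p : {poly R}) (b : seq R) (l : nat).

(** Consecutive products with even index differ by one factor $b_{2j-1}b_{2j}$. *)
Lemma schwarz_condP l b : (1 <= l)%N ->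
  schwarz_cond l b <-> even_pos (2 * l) (nth 0 b).
Proof.
move=> l0; have step j : bprod (nth 0 b) (2 * j.+1)
    = bprod (nth 0 b) (2 * j) * (b`_(2 * j.+1 - 1) * b`_(2 * j.+1)).
  have -> : (2 * j.+1 = (2 * j).+2)%N by lia.
  by rewrite !bprodS mulrA subn1.
split=> [[b0 bb] k kl ok|epos].
  have -> : (k = 2 * k./2)%N by lia.
  have : (k./2 < l)%N by lia.
  elim: (k./2) => [_|j IH jl]; first by rewrite muln0 bprod0.
  by rewrite step mulr_gt0 ?IH ?bb //; lia.
split; first by rewrite -(bprod0 (nth 0 b)); apply: epos => //; lia.
move=> [//|j] jl.
have : 0 < bprod (nth 0 b) (2 * j.+1) by apply: epos; lia.
by rewrite step pmulr_rgt0 //; apply: epos; lia.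
Qed.

Lemma num_neg_productsE l b :
  num_neg_products l b = odd_neg (2 * l) (nth 0 b).
Proof.
rewrite odd_negE ?oddM // mul2n doubleK /num_neg_products.
apply: eq_in_count => i; rewrite mem_iota /bprod => /andP[i0 _].
by rewrite prednK //; lia.
Qed.

Lemma hurwitz_detE p j : hurwitz_det p j =
  \det (hmat (fun k => hcoef p (2 * k)%N) (fun k => hcoef p (2 * k).+1) j).
Proof.
have neg (x : int) : x < 0 -> hcoef p x = 0 by case: x.
congr (\det _); apply/matrixP => r s; rewrite !mxE.
case: ltnP => rs; first by apply: neg; lia.
by case: ifP => ro; congr (hcoef p _); lia.
Qed.

Lemma schwarz_poly_exists p n : (0 < n)%N -> p \is monic -> degree p = n ->
  (forall j, (1 <= j <= n)%N -> hurwitz_det p j != 0) ->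
  exists2 b, (forall k, (k < n)%N -> b k != 0) & p = schwarz_polyX n b.
Proof.
case: n => // m _ mp dp dets.
set u := fun k : nat => hcoef p (2 * k)%N; set v := fun k : nat => hcoef p (2 * k).+1.
have u0 : u 0%N = 1.
  by rewrite /u /hcoef muln0 leq0n subn0 -[RHS](monicP mp).
have usup i : (m.+1 < 2 * i)%N -> u i = 0 by move=> ?; rewrite /u /hcoef dp ifF //; lia.
have vsup i : (m < 2 * i)%N -> v i = 0 by move=> ?; rewrite /v /hcoef dp ifF //; lia.
have dets' j : (1 <= j <= m.+1)%N -> \det (hmat u v j) != 0.
  by move=> /dets; rewrite hurwitz_detE.
have v0 : v 0%N != 0 by have := dets' 1%N isT; rewrite det_mx11 mxE.
have [|b [b0 ub vb]] := hmat_cont_coef 0 usup vsup _ dets'.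
  by rewrite u0 oner_eq0.
(* The continuants from index $0$ on do not involve $b_0$; it is $a_1$, the leading coefficient of
   the other parity part. *)
pose c i := if i is 0%N then v 0%N else b i.
have cb j : (0 < j)%N -> c j = b j by case: j.
have [_ sc] := schwarz_polyX_monic_size c (ltn0Sn m).
have sp : size p = m.+2 by rewrite -dp /degree prednK // size_poly_gt0 monic_neq0.
exists c => [[|k] km|]; [by []| by rewrite cb // b0 //; lia|].
apply/polyP => j; have [jm|jm] := leqP j m.+1; last by rewrite !nth_default ?sc ?sp.
have hc k : (k <= m.+1)%N -> hcoef p k = p`_(m.+1 - k) by rewrite /hcoef dp => ->.
have [oj|oj] := boolP (odd (m.+1 - j)).
  have -> : (j = m - 2 * (m.+1 - j)./2)%N by lia.
  rewrite coef_schwarz_odd; last by lia.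
  rewrite (eq_cont_coef (b' := b)) => [|i i0]; last by apply: cb; lia.
  by rewrite -vb /v hc; [congr (p`_ _); lia|lia].
have -> : (j = m.+1 - 2 * (m.+1 - j)./2)%N by lia.
rewrite coef_schwarz_even; last by lia.
rewrite (eq_cont_coef (b' := b)) => [|i i0]; last by apply: cb.
by have := ub (m.+1 - j)./2; rewrite u0 mul1r => <-; rewrite /u hc //; lia.
Qed.

End Translation.

Theorem theorem5p1 (R : realType) (n l : nat) (hl : (1 <= l)%N)
    (hn : n = (2 * l)%N) :
  (forall b : n.-tuple R,
     (forall k, (k < n)%N -> b`_k != 0) ->
     (hurwitzI (char_poly (schwarz_mx b)) <-> schwarz_cond l b) /\
     (hurwitzI (char_poly (schwarz_mx b)) ->
      forall kappa, hurwitzI_of_order (char_poly (schwarz_mx b)) kappa ->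
        kappa = num_neg_products l b)) /\
  (forall (lambda : n.-tuple R[i]) (p : {poly R}) (kappa : nat),
     map_poly (real_complex R) p = \prod_(k < n) ('X - (tnth lambda k)%:P) ->
     hurwitzI_of_order p kappa ->
     (forall j, (1 <= j <= n)%N -> hurwitz_det p j != 0) ->
     exists! J : 'M[R]_n,
       exists b : n.-tuple R,
         [/\ J = schwarz_mx b,
             forall k, (k < n)%N -> b`_k != 0,
             schwarz_cond l b,
             num_neg_products l b = kappa
           & perm_eq (spectrum J) lambda]).
Proof.
have n0 : (0 < n)%N by lia.
have evn : ~~ odd n by lia.
have direct (b : n.-tuple R) : (forall k, (k < n)%N -> b`_k != 0) ->
    (hurwitzI (char_poly (schwarz_mx b)) <-> schwarz_cond l b) /\
    forall kappa, hurwitzI_of_order (char_poly (schwarz_mx b)) kappa ->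
      kappa = num_neg_products l b.
  move=> b0; rewrite char_poly_schwarz // num_neg_productsE schwarz_condP // -hn.
  split=> [|kappa /(schwarz_even_pos n0 evn b0)[]//].
  split=> [[kappa /(schwarz_even_pos n0 evn b0)[]//]|].
  exact: even_pos_schwarz.
split=> [b b0|lambda p kappa plam Hp dets].
  by have [] := direct b b0; split.
have mp : p \is monic.
  by rewrite -(map_monic (real_complex R)) plam monic_prod_XsubC.
have zp : perm_eq (zeros p) lambda.
  by apply: prod_XsubC_eq; rewrite -zeros_prod // plam big_tuple.
have dp : degree p = n by rewrite -size_zeros // (perm_size zp) size_tuple.
have [b b0 pb] := schwarz_poly_exists n0 mp dp dets.
pose bt := [tuple b i | i < n].
have btE i : (i < n)%N -> bt`_i = b i.
  by move=> ilt; rewrite (nth_map (Ordinal ilt)) ?size_enum_ord // nth_enum_ord.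
have bt0 k : (k < n)%N -> bt`_k != 0 by move=> kn; rewrite btE // b0.
have cpE : char_poly (schwarz_mx bt) = p.
  rewrite char_poly_schwarz // pb /schwarz_polyX /schwarz_poly /= btE //.
  by congr (_ + _ * _); apply: eq_cont => i ilt /=; rewrite btE //; lia.
have [[cond _] ord] := direct bt bt0; rewrite cpE in cond ord.
exists (schwarz_mx bt); split.
  exists bt; split=> //; first by apply: cond; exists kappa.
    exact/esym/ord.
  by rewrite /spectrum cpE.
(* Uniqueness: the spectrum fixes the monic characteristic polynomial, whose coefficients determine
   the entries. *)
move=> _ [b' [-> b'0 _ _ spb']].
have e : char_poly (schwarz_mx b') = p.
  apply: (map_poly_inj (real_complex R)).
  rewrite !zeros_prod ?char_poly_monic //; apply: perm_big.
  by rewrite (perm_trans spb') // perm_sym.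
congr schwarz_mx; apply: val_inj; apply: (@eq_from_nth _ 0) => [|i]; rewrite ?size_tuple // => ilt.
apply: (schwarz_polyX_inj n0 (b := nth 0 bt)) => //.
by rewrite -!char_poly_schwarz // e cpE.
Qed.
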